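(* Let $G$ be a locally compact, second countable group equipped with a proper length function $|\cdot|$. Let $(G_i)_{i\in\mathbb{N}}$ be a normalized nested sequence of open subgroups of $G$, each equipped with the restriction of $|\cdot|$ to $G_i$, such that $\varinjlim G_i = G$ and $\alpha := \inf_{i\in\mathbb{N}} \alpha_2^{\#}(G_i) > 0$. Let $l,q\ge 0$ be real numbers and suppose that $(G_i)_{i\in\mathbb{N}}$ has the $(\alpha,l,q)$-polynomial property. Then $$ l\ge q \ \Rightarrow\ \alpha_2^{\#}(G)\ \ge\ \frac{\alpha}{2l+1}, \qquad\text{and}\qquad l\le q\ \Rightarrow\ \alpha_2^{\#}(G)\ \ge\ \frac{\alpha}{l+q+1}.$$
   Context: All groups are locally compact and second countable, and all actions are continuous. Here $\mathbb{N}=\{1,2,3,\dots\}$. A length function on $G$ is a map $|\cdot|:G\to[0,\infty)$ with $|g|=0$ iff $g=e$, $|g^{-1}|=|g|$ and $|gh|\le |g|+|h|$. It is proper if its closed balls $\{g: |g|\le r\}$ are compact. A 1-cocycle associated to a (continuous) unitary representation $\pi$ of a group $G$ on a Hilbert space $\mathcal{H}$ is a continuous map $b:G\to\mathcal{H}$ with $b(gh)=\pi(g)b(h)+b(g)$ for all $g,h\in G$. It is large-scale Lipschitz (with respect to $|\cdot|$) if there are $C,D>0$ with $\|b(g)\|\le C|g|+D$ for all $g\in G$. For such a $b$, its compression $R(b)$ is the supremum of the $r\in[0,1]$ for which there exist $C,D>0$ with $\frac1C|g|^r-D\le\|b(g)\|\le C|g|+D$ for all $g\in G$. The equivariant Hilbert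 space compression $\alpha_2^{\#}(G)$ of a group with proper length function $|\cdot|$ is the supremum of $R(b)$ over all large-scale Lipschitz 1-cocycles $b$ associated to unitary representations of $G$ on Hilbert spaces. For each $G_i$, $\alpha_2^{\#}(G_i)$ is taken with respect to the restriction of $|\cdot|$. Nested sequence with $\varinjlim G_i=G$ means $G_1\subset G_2\subset\cdots\subset G$ and $\bigcup_i G_i=G$. Normalized means that for every $i\in\mathbb{N}$ and every $g\in G$ with $|g|<i$ one has $g\in G_i$. $(\alpha,l,q)$-polynomial property: assume $\alpha=\inf_i\alpha_2^{\#}(G_i)\in(0,1]$ and $l,q\ge 0$. A normalized nested sequence $(G_i)_{i\in\mathbb{N}}$ of open subgroups with $\varinjlim G_i=G$ has the $(\alpha,l,q)$-polynomial property if there exist: (1) a sequence $(\eta_i)_{i}$ of nonnegative reals converging to $0$ with $\eta_i<\alpha$ for all $i$; (2) pairs $(A_i,B_i)\in\mathbb{R}^{>0}\times\mathbb{R}^{\ge0}$, $i\in\mathbb{N}$; (3) 1-cocycles $b_i:G_i\to\mathcal{H}_i$, each associated to a unitary representation $\pi_i$ of $G_i$ on a Hilbert space $\mathcal{H}_i$; such that $$\frac1{A_i}|g|^{2\alpha-\eta_i}-B_i\ \le\ \|b_i(g)\|^2\ \le\ A_i|g|^2+B_i\qquad\text{for all } g\in G_i,\ i\in\mathbb{N},$$ and there are $C,D>0$ with $A_i\le C i^l$ and $B_i\le D i^q$ for all $i\in\mathbb{N}$. *)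

(* Defs.v *)
From HB Require Import structures.
From mathcomp Require Import all_boot all_order all_algebra.
From mathcomp Require Import complex.
From mathcomp Require Import all_classical all_reals all_analysis.

Set Implicit Arguments.
Unset Strict Implicit.
Unset Printing Implicit Defensive.

Import Order.TTheory GRing.Theory Num.Theory Num.Def.
Import numFieldNormedType.Exports.

Local Open Scope classical_set_scope.
Local Open Scope ring_scope.

HB.structure Definition PreTopologicalGroup := {G of Topological G & Group G}.

HB.mixin Record PreTopologicalGroup_isTopologicalGroup G
    & PreTopologicalGroup G := {
  mulg_continuous : continuous (fun x : G * G => (x.1 * x.2)%g) ;
  invg_continuous : continuous (fun x : G => (x^-1)%g) ;
}.

#[short(type="topologicalGroupType")]
HB.structure Definition TopologicalGroup :=
  {G of PreTopologicalGroup G & PreTopologicalGroup_isTopologicalGroup G}.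

(* Complex Hilbert spaces. By the conventions of [{dot _ for _}], [dotp] is
   linear on the left and conjugate-linear on the right. *)
HB.mixin Record CompleteNormedModule_isHilbert (R : realType) H
    & CompleteNormedModule R[i] H := {
  dotp : {dot H for @conjC R[i]} ;
  sqr_normE : forall x : H, `|x| ^+ 2 = dotp x x ;
}.

#[short(type="hilbertType")]
HB.structure Definition Hilbert (R : realType) :=
  {H of CompleteNormedModule R[i] H & CompleteNormedModule_isHilbert R H}.

(* The norm of [H] takes its values in R[i]; this is the same norm, in R. *)
Definition hnorm (R : realType) (H : hilbertType R) (x : H) : R :=
  complex.Re `|x|.

Definition unitary (R : realType) (H : hilbertType R) (f : H -> H) :=
  [/\ linear f, forall x y, dotp (f x) (f y) = dotp x y
    & forall y, exists x, f x = y].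

Section length.
Variables (R : realType) (G : topologicalGroupType).

Definition length_function (len : G -> R) :=
  [/\ forall g, 0 <= len g,
      forall g, len g = 0 <-> g = 1%g,
      forall g, len g^-1%g = len g
    & forall g h, len (g * h)%g <= len g + len h].

Definition proper_length_function (len : G -> R) :=
  length_function len /\ forall r : R, compact [set g | len g <= r].

End length.

(* As for finite groups in MathComp, subgroups are subsets of an ambient group:
   below, S stands for a subgroup of G with the subspace topology and the
   restriction of the length function. The maps on S are maps on G whose values
   outside S are irrelevant, and G itself is the case S = setT. *)
Section compression.
Variables (R : realType) (G : topologicalGroupType).

Definition unitary_representation (S : set G) (H : hilbertType R)
    (pi : G -> H -> H) :=
  [/\ forall g, S g -> unitary (pi g),
      forall v, pi 1%g v = v,
      forall g h, S g -> S h -> forall v, pi (g * h)%g v = pi g (pi h v)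
    & forall v, {within S, continuous (pi ^~ v)}].

Definition cocycle (S : set G) (H : hilbertType R) (pi : G -> H -> H)
    (b : G -> H) :=
  [/\ unitary_representation S pi,
      {within S, continuous b}
    & forall g h, S g -> S h -> b (g * h)%g = pi g (b h) + b g].

Variable len : G -> R.

Definition large_scale_lipschitz (S : set G) (H : hilbertType R) (b : G -> H) :=
  exists C D : R, [/\ 0 < C, 0 < D
    & forall g, S g -> hnorm (b g) <= C * len g + D].

Definition compression (S : set G) (H : hilbertType R) (b : G -> H) : R :=
  sup [set r | 0 <= r <= 1 /\
    exists C D : R, [/\ 0 < C, 0 < D
      & forall g, S g ->
          C^-1 * len g `^ r - D <= hnorm (b g) <= C * len g + D]].

Definition equivariant_compression (S : set G) : R :=
  sup [set x | exists (H : hilbertType R) (pi : G -> H -> H) (b : G -> H),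
    [/\ cocycle S pi b, large_scale_lipschitz S b & x = compression S b]].

End compression.

(* Sequences of subgroups are indexed by the positive integers; their value at
   index 0 is irrelevant. *)
Section sequence.
Variables (R : realType) (G : topologicalGroupType) (len : G -> R).

Definition open_subgroup (S : set G) := open S /\ group_closed [in S].

Definition nested (Gs : nat -> set G) :=
  (forall i, (0 < i)%N -> Gs i `<=` Gs i.+1) /\
  \bigcup_(i in [set i | (0 < i)%N]) Gs i = setT.

Definition normalized (Gs : nat -> set G) :=
  forall i, (0 < i)%N -> forall g, len g < i%:R -> Gs i g.

Definition inf_compression (Gs : nat -> set G) : R :=
  inf [set equivariant_compression len (Gs i) | i in [set i | (0 < i)%N]].

Definition polynomial_property (Gs : nat -> set G) (alpha l q : R) :=
  exists (eta A B : nat -> R) (H : nat -> hilbertType R)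
      (pi : forall i, G -> H i -> H i) (b : forall i, G -> H i),
    [/\ forall i, (0 < i)%N -> 0 <= eta i < alpha,
        eta @ \oo --> (0 : R),
        forall i, (0 < i)%N -> 0 < A i /\ 0 <= B i,
        forall i, (0 < i)%N -> cocycle (Gs i) (pi i) (b i)
      & (forall i, (0 < i)%N -> forall g, Gs i g ->
          (A i)^-1 * len g `^ (2 * alpha - eta i) - B i
            <= hnorm (b i g) ^+ 2 <= A i * len g ^+ 2 + B i) /\
        exists C D : R, [/\ 0 < C, 0 < D
          & forall i, (0 < i)%N ->
              A i <= C * i%:R `^ l /\ B i <= D * i%:R `^ q]].

End sequence.

(* Main.v *)
From HB Require Import structures.
Require Import Defs.
From mathcomp Require Import all_boot all_order all_algebra.
From mathcomp Require Import complex ring lra.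
From mathcomp Require Import all_classical all_reals all_analysis.

(** It suffices to realize every exponent r < alpha / (l + m + 1), where
    m = max(l, q). Put t_i = i^-(m + 1 + e) for a small e > 0. Each function
    phi_i(g) = exp(- t_i |b_i(g)|^2) on G_i, extended by 0 to G, is continuous
    and positive definite (Schoenberg), because G_i is open. The function
    psi = \sum_i (1 - phi_i) is then conditionally of negative type, and
    2 psi(g) = |b(g)|^2 for a cocycle b on the reproducing kernel Hilbert space
    of the Gromov kernel psi(x) + psi(y) - psi(x^-1 y), on which G acts by
    f |-> f(g^-1 x) - f(g^-1).
    For i > |g| the i-th term is at most t_i (A_i |g|^2 + B_i), which is
    O(i^-(1 + e)) (|g|^2 + 1), while the other terms are at most 1: hence
    psi(g) = O(|g|^2 + 1). For i up to a constant times |g|^(2 r), the i-th term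
    is at least 1/2: hence psi(g) is at least of the order of |g|^(2 r). *)

Set Implicit Arguments.
Unset Strict Implicit.
Unset Printing Implicit Defensive.

Import Order.TTheory GRing.Theory Num.Theory.
Import numFieldNormedType.Exports.

Local Open Scope classical_set_scope.
Local Open Scope ring_scope.

(** * Positive semidefinite kernels *)

(** The cocycles [b i] live on proper subgroups and are unbounded, so they can be neither extended
    by 0 nor summed as they stand. Gaussians are bounded, and extending them by 0 keeps positivity
    because distinct cosets of the subgroup become orthogonal. In t_i, the exponent m absorbs the
    growth of A_i and B_i in the upper bound and 1 + e makes the series converge. The lower bound
    pays for A_i once more: it needs i^(l + m + 1 + e) of order at most |g|^(2 alpha - eta_i),
    whence the denominator l + m + 1. The growth of psi comes from the number of terms above 1/2,
    not from their size. The two claims are the cases m = l and m = q. Continuity of psi is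
    delicate: the tails are controlled by |g|, and must be small uniformly near each point although
    [len] need not be continuous. The Hilbert space is a set of functions normed by a supremum over
    finitely supported measures. This avoids quotients and completions, and reduces invariance under
    G to a change of variable on measures; in exchange, the parallelogram law and the linearity of
    the inner product have to be derived from the supremum. *)

Section combinations.
Variables (R : realType) (X : Type).
Implicit Types (f g : X -> R) (u v w : seq (R * X)) (K : X -> X -> R).

(* A list of pairs (coefficient, point) stands for a finitely supported measure
   [u]; [ev f u] is the integral of [f]. *)
Definition ev f u : R := \sum_(p <- u) p.1 * f p.2.

Definition scl (a : R) u := [seq (a * p.1, p.2) | p <- u].

Lemma ev_nil f : ev f [::] = 0.
Proof. by rewrite /ev big_nil. Qed.

Lemma ev_cons f p u : ev f (p :: u) = p.1 * f p.2 + ev f u.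
Proof. by rewrite /ev big_cons. Qed.

Lemma ev_cat f u v : ev f (u ++ v) = ev f u + ev f v.
Proof. by rewrite /ev big_cat. Qed.

Lemma ev_scl f a u : ev f (scl a u) = a * ev f u.
Proof.
by rewrite /ev big_map mulr_sumr; apply: eq_bigr => p _; rewrite mulrA.
Qed.

Lemma evP f g a u : ev (fun x => a * f x + g x) u = a * ev f u + ev g u.
Proof.
rewrite /ev mulr_sumr -big_split; apply: eq_bigr => p _ /=.
by rewrite mulrDr !mulrA [p.1 * a]mulrC.
Qed.

Lemma ev_ext f g u : f =1 g -> ev f u = ev g u.
Proof. by move=> fg; apply: eq_bigr => p _; rewrite fg. Qed.

Definition gram K u v := ev (fun x => ev (K x) v) u.

Definition psd K :=
  (forall x y, K x y = K y x) /\ forall u, 0 <= gram K u u.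

Lemma gram_catl K u v w : gram K (u ++ v) w = gram K u w + gram K v w.
Proof. exact: ev_cat. Qed.

Lemma gram_catr K u v w : gram K w (u ++ v) = gram K w u + gram K w v.
Proof.
rewrite /gram -[X in X + _]mul1r -evP; apply: ev_ext => x.
by rewrite ev_cat mul1r.
Qed.

Lemma gram_scll K a u v : gram K (scl a u) v = a * gram K u v.
Proof. exact: ev_scl. Qed.

Lemma gram_sclr K a u v : gram K v (scl a u) = a * gram K v u.
Proof.
rewrite /gram /ev mulr_sumr; apply: eq_bigr => p _.
by rewrite -!/(ev _ _) ev_scl mulrCA.
Qed.

Lemma gram_sym K u v : (forall x y, K x y = K y x) ->
  gram K u v = gram K v u.
Proof.
move=> Ks; rewrite /gram /ev.
under eq_bigr do rewrite mulr_sumr.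
rewrite exchange_big /=; apply: eq_bigr => q _; rewrite mulr_sumr.
by apply: eq_bigr => p _; rewrite Ks; ring.
Qed.

Lemma gram_cons K p u : (forall x y, K x y = K y x) ->
  gram K (p :: u) (p :: u) =
  p.1 ^+ 2 * K p.2 p.2 + 2 * p.1 * ev (K p.2) u + gram K u u.
Proof.
move=> Ks; rewrite -cat1s gram_catl !gram_catr [gram K u [:: p]]gram_sym//.
have E v : gram K [:: p] v = p.1 * ev (K p.2) v.
  by rewrite /gram ev_cons ev_nil addr0.
rewrite !E ev_cons ev_nil; ring.
Qed.

Lemma gramE K u : gram K u u =
  \sum_(p <- u) \sum_(q <- u) p.1 * q.1 * K p.2 q.2.
Proof.
rewrite /gram /ev; apply: eq_bigr => p _; rewrite mulr_sumr.
by apply: eq_bigr => q _; rewrite mulrA.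
Qed.

Lemma gram1 K a x : gram K [:: (a, x)] [:: (a, x)] = a ^+ 2 * K x x.
Proof. by rewrite /gram !(ev_cons, ev_nil)/=; ring. Qed.

Section psd_kernel.
Variable K : X -> X -> R.
Hypothesis Kpsd : psd K.

Lemma psd_diag_ge0 x : 0 <= K x x.
Proof. by have := Kpsd.2 [:: (1, x)]; rewrite gram1 expr1n mul1r. Qed.

Lemma psd_diag_eq0 x y : K x x = 0 -> K x y = 0.
Proof.
move=> Kx0; apply/eqP/negP => /negP Kxy.
(* With [K x x = 0] the quadratic form is affine in the mass at x; this mass makes its value -1. *)
have := Kpsd.2 [:: (- ((K y y + 1) / (2 * K x y)), x); (1, y)].
rewrite gram_cons ?gram1; last exact: Kpsd.1.
rewrite Kx0 !(ev_cons, ev_nil)/= !(mul1r, mulr0, addr0, add0r, expr1n).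
rewrite (_ : _ * _ * K x y = - (K y y + 1)); last by field.
by move=> ?; lra.
Qed.

(** If [K z z = 0], the quotient is 0 by the convention on inverses and the complement is [K]
    itself, which then already vanishes at z. *)
Definition schur_compl z x y := K x y - K x z * K z y / K z z.

Lemma schur_compl_eq0 z y : schur_compl z z y = 0.
Proof.
rewrite /schur_compl; have [Kz0|Kz] := eqVneq (K z z) 0.
  by rewrite (psd_diag_eq0 y Kz0) mulr0 mul0r subrr.
by rewrite mulrAC divff// mul1r subrr.
Qed.

(** Orthogonal projection away from z: the new form at [u] is the old one at [u] plus the mass at z
    that minimizes it, namely [- (ev (K z) u / K z z)]. *)
Lemma schur_compl_psd z : psd (schur_compl z).
Proof.
split=> [x y|u].
  by rewrite /schur_compl Kpsd.1 (Kpsd.1 x z) (Kpsd.1 z y) [K z x * _]mulrC.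
have -> : gram (schur_compl z) u u = gram K u u - ev (K z) u ^+ 2 / K z z.
  have E x : ev (schur_compl z x) u =
      (- (ev (K z) u / K z z)) * K z x + ev (K x) u.
    rewrite (@ev_ext _ (fun y => - (K x z / K z z) * K z y + K x y)) => [|y].
      by rewrite evP (Kpsd.1 x z); ring.
    by rewrite /schur_compl addrC mulNr mulrAC.
  rewrite /gram (ev_ext _ E) evP.
  by rewrite addrC mulNr expr2 mulrAC.
have [Kz0|Kz] := eqVneq (K z z) 0.
  by rewrite Kz0 invr0 mulr0 subr0 Kpsd.2.
have := Kpsd.2 ((- (ev (K z) u / K z z), z) :: u).
rewrite gram_cons; last exact: Kpsd.1.
by congr (0 <= _) => /=; field.
Qed.

End psd_kernel.

(* Schur product theorem: split off from [A] the rank one kernel carried by the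
   first point, which leaves a Schur complement vanishing there. *)
Lemma psd_trace_ge0 (A B : X -> X -> R) (s : seq X) : psd A -> psd B ->
  0 <= \sum_(x <- s) \sum_(y <- s) A x y * B x y.
Proof.
move=> + Bpsd; elim: s A => [|z s IHs] A Apsd; first by rewrite big_nil.
have E x y : A x y * B x y =
    (A z z)^-1 * (A z x * A z y * B x y) + schur_compl A z x y * B x y.
  by rewrite /schur_compl (Apsd.1 x z); ring.
under eq_bigr => x _ do under eq_bigr => y _ do rewrite E.
under eq_bigr do rewrite big_split/=.
rewrite big_split /= addr_ge0//.
  under eq_bigr do rewrite -mulr_sumr.
  rewrite -mulr_sumr mulr_ge0 ?invr_ge0 ?psd_diag_ge0//.
  have := Bpsd.2 [seq (A z x, x) | x <- z :: s].
  rewrite /gram /ev big_map; congr (_ <= _); apply: eq_bigr => x _.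
  rewrite big_map mulr_sumr /=; apply: eq_bigr => y _; ring.
have Az := schur_compl_psd Apsd z.
rewrite big_cons big1 ?add0r; last first.
  by move=> y _; rewrite schur_compl_eq0// mul0r.
have := IHs _ Az; congr (_ <= _); apply: eq_bigr => x _.
by rewrite big_cons Az.1 schur_compl_eq0// mul0r add0r.
Qed.

End combinations.

Section psd_closure.
Variables (R : realType) (X : Type).
Implicit Types K A B : X -> X -> R.

Lemma psd_comp (Y : Type) (h : Y -> X) K :
  psd K -> psd (fun x y => K (h x) (h y)).
Proof.
move=> Kpsd; split=> [x y|u]; first exact: Kpsd.1.
have := Kpsd.2 [seq (p.1, h p.2) | p <- u].
rewrite !gramE big_map; congr (_ <= _); apply: eq_bigr => p _.
by rewrite big_map.
Qed.

Lemma psd_mul A B : psd A -> psd B -> psd (fun x y => A x y * B x y).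
Proof.
move=> Apsd Bpsd; split=> [x y|u]; first by rewrite Apsd.1 Bpsd.1.
(* [psd_trace_ge0] has no coefficients. Taking the pairs (coefficient, point) as the points of new
   kernels lets [B'] carry the coefficients. *)
pose A' (p q : R * X) := A p.2 q.2.
pose B' (p q : R * X) := p.1 * q.1 * B p.2 q.2.
have A'psd : psd A' by exact: (psd_comp snd Apsd).
have B'psd : psd B'.
  split=> [p q|v]; first by rewrite /B' Bpsd.1 [p.1 * _]mulrC.
  have := Bpsd.2 [seq (p.1 * p.2.1, p.2.2) | p <- v].
  rewrite !gramE big_map; congr (_ <= _); apply: eq_bigr => p _.
  rewrite big_map; apply: eq_bigr => q _.
  by rewrite /B' /=; ring.
have := psd_trace_ge0 u A'psd B'psd; rewrite gramE; congr (_ <= _).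
by apply: eq_bigr => p _; apply: eq_bigr => q _; rewrite /A' /B'; ring.
Qed.

Lemma psd_add A B : psd A -> psd B -> psd (fun x y => A x y + B x y).
Proof.
move=> Apsd Bpsd; split=> [x y|u]; first by rewrite Apsd.1 Bpsd.1.
rewrite gramE.
under eq_bigr => p _ do under eq_bigr => q _ do rewrite mulrDr.
under eq_bigr do rewrite big_split/=.
by rewrite big_split/= -!gramE addr_ge0 ?Apsd.2 ?Bpsd.2.
Qed.

Lemma psd_rank1 (f : X -> R) : psd (fun x y => f x * f y).
Proof.
split=> [x y|u]; first by rewrite mulrC.
rewrite (_ : gram _ u u = ev f u ^+ 2) ?sqr_ge0// gramE /ev expr2 mulr_suml.
apply: eq_bigr => p _; rewrite mulr_sumr; apply: eq_bigr => q _; ring.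
Qed.

Lemma cvg_ev (T : Type) (F : set_system T) (FF : Filter F)
    (fn : T -> X -> R) f u :
  (forall x, fn n x @[n --> F] --> f x) -> ev (fn n) u @[n --> F] --> ev f u.
Proof.
move=> fnf; elim: u => [|p u IHu].
  by rewrite ev_nil; under eq_fun do rewrite ev_nil; exact: cvg_cst.
rewrite ev_cons; under eq_fun do rewrite ev_cons.
by apply: cvgD => //; apply: cvgM => //; exact: cvg_cst.
Qed.

Lemma psd_cvg (T : Type) (F : set_system T) (FF : ProperFilter F)
    (Kn : T -> X -> X -> R) K : (forall n, psd (Kn n)) ->
  (forall x y, Kn n x y @[n --> F] --> K x y) -> psd K.
Proof.
move=> Kpsd Kcvg.
split=> [x y|u].
  apply: (cvg_unique _ (Kcvg x y)); first exact: Rhausdorff.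
  rewrite (_ : (fun n => Kn n x y) = (fun n => Kn n y x)); first exact: Kcvg.
  by apply/funext => n; rewrite (Kpsd n).1.
have gcvg : gram (Kn n) u u @[n --> F] --> gram K u u.
  by apply: cvg_ev => x; apply: cvg_ev => y.
by apply: cvgr_to_ge gcvg _; apply: nearW => n; exact: (Kpsd n).2.
Qed.

End psd_closure.

(** * Reproducing kernel Hilbert spaces *)

Lemma discriminant_le (R : realFieldType) (a b c : R) : 0 <= a ->
  (forall t, 0 <= t ^+ 2 * a + 2 * t * b + c) -> b ^+ 2 <= a * c.
Proof.
rewrite le_eqVlt => /predU1P[<-|a0] abc.
  have [->|b0] := eqVneq b 0; first by rewrite expr0n mul0r.
  have := abc (- (c + 1) / (2 * b)); rewrite mulr0 add0r.
  by rewrite (_ : 2 * _ * b = - (c + 1)); [lra|field].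
have := abc (- b / a).
rewrite (_ : _ + _ + c = (a * c - b ^+ 2) / a); last by field; rewrite gt_eqF.
by rewrite pmulr_lge0 ?invr_gt0// subr_ge0.
Qed.

Section real_rkhs.
Variables (R : realType) (X : Type) (K : X -> X -> R).
Hypothesis Kpsd : psd K.
Implicit Types (f g h : X -> R) (u v w : seq (R * X)).

Let Ksym := Kpsd.1.

Definition energy f u := 2 * ev f u - gram K u u.

(** By rescaling [u], this says that [u |-> ev f u] is bounded for the seminorm of [gram K], the
    usual criterion for membership in the reproducing kernel space. *)
Definition in_rkhs f := exists M, forall u, energy f u <= M.

(* By the Riesz representation theorem, the supremum over [u] of
   2 <f, k_u> - |k_u|^2 is |f|^2. *)
Definition sqnorm f : R := sup (range (energy f)).

Lemma energy_nil f : energy f [::] = 0.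
Proof. by rewrite /energy /gram !ev_nil mulr0 subr0. Qed.

Lemma energy_le f u : in_rkhs f -> energy f u <= sqnorm f.
Proof.
move=> [M fM]; apply: ub_le_sup; last by exists u.
by exists M => _ [v _ <-].
Qed.

Lemma sqnorm_le f M : (forall u, energy f u <= M) -> sqnorm f <= M.
Proof.
move=> fM; apply: ge_sup; first by exists (energy f [::]); exists [::].
by move=> _ [v _ <-].
Qed.

Lemma sqnorm_ge0 f : in_rkhs f -> 0 <= sqnorm f.
Proof. by move=> /(energy_le [::]); rewrite energy_nil. Qed.

Lemma sqnormD_le f g M : in_rkhs f -> in_rkhs g ->
  (forall u v, energy f u + energy g v <= M) -> sqnorm f + sqnorm g <= M.
Proof.
move=> Hf Hg fgM; rewrite -lerBrDr; apply: sqnorm_le => u.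
rewrite lerBrDr addrC -lerBrDr; apply: sqnorm_le => v.
by rewrite lerBrDr addrC.
Qed.

Let rotate a b u v : seq (R * X) := scl a u ++ scl b v.

Lemma ev_linear f g a b u : ev (a *: f + b *: g) u = a * ev f u + b * ev g u.
Proof.
rewrite /ev !mulr_sumr -big_split; apply: eq_bigr => p _ /=.
by rewrite (_ : (a *: f + b *: g) p.2 = a * f p.2 + b * g p.2)//; ring.
Qed.

(** A rotation and scaling of the pair (f, g) is moved onto the pair of measures. This is where the
    supremum becomes a quadratic form: a = b = 1 yields the parallelogram law. *)
Lemma energy_rotate f g a b u v : a ^+ 2 + b ^+ 2 != 0 ->
  let s := a ^+ 2 + b ^+ 2 in
  energy (a *: f + b *: g) u + energy (a *: g - b *: f) v =
  s * energy f (rotate (a / s) (- b / s) u v) +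
  s * energy g (rotate (b / s) (a / s) u v).
Proof.
move=> s0 s; rewrite -scaleNr /energy !ev_linear /rotate !ev_cat !ev_scl.
rewrite !gram_catl !gram_catr !gram_scll !gram_sclr (gram_sym v u Ksym).
by rewrite /s; field.
Qed.

Lemma sqr_sum_gt0 (a b : R) : b != 0 -> 0 < a ^+ 2 + b ^+ 2.
Proof. by move=> b0; rewrite ltr_wpDl ?sqr_ge0// exprn_even_gt0. Qed.

Lemma in_rkhsP f g a b : b != 0 -> in_rkhs f -> in_rkhs g ->
  in_rkhs (a *: f + b *: g).
Proof.
move=> b0 Hf Hg; have s0 := sqr_sum_gt0 a b0.
exists ((a ^+ 2 + b ^+ 2) * (sqnorm f + sqnorm g)) => u.
have := energy_rotate f g u [::] (lt0r_neq0 s0).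
rewrite energy_nil addr0 => ->; rewrite -mulrDr ler_wpM2l ?(ltW s0)//.
by rewrite lerD ?energy_le.
Qed.

Lemma in_rkhs0 : in_rkhs 0.
Proof.
exists 0 => u; rewrite /energy /ev big1 => [|p _]; last by rewrite mulr0.
by rewrite mulr0 sub0r oppr_le0 Kpsd.2.
Qed.

Lemma in_rkhsD f g : in_rkhs f -> in_rkhs g -> in_rkhs (f + g).
Proof.
by move=> Hf Hg; have := in_rkhsP 1 (oner_neq0 R) Hf Hg; rewrite !scale1r.
Qed.

Lemma in_rkhsZ a f : in_rkhs f -> in_rkhs (a *: f).
Proof.
move=> Hf; have := in_rkhsP a (oner_neq0 R) Hf in_rkhs0.
by rewrite scaler0 addr0.
Qed.

Lemma in_rkhsN f : in_rkhs f -> in_rkhs (- f).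
Proof. by rewrite -scaleN1r; exact: in_rkhsZ. Qed.

Lemma in_rkhsB f g : in_rkhs f -> in_rkhs g -> in_rkhs (f - g).
Proof. by move=> Hf Hg; apply: in_rkhsD => //; exact: in_rkhsN. Qed.

Lemma sqnorm_rotate_le f g a b : b != 0 -> in_rkhs f -> in_rkhs g ->
  sqnorm (a *: f + b *: g) + sqnorm (a *: g - b *: f) <=
  (a ^+ 2 + b ^+ 2) * (sqnorm f + sqnorm g).
Proof.
move=> b0 Hf Hg; have s0 := sqr_sum_gt0 a b0.
apply: sqnormD_le => [||u v]; rewrite ?energy_rotate ?gt_eqF//; last first.
  by rewrite -mulrDr ler_wpM2l ?(ltW s0)// lerD ?energy_le.
- by apply: in_rkhsB; exact: in_rkhsZ.
- exact: in_rkhsP.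
Qed.

Lemma sqnorm_scale_le a f : in_rkhs f -> sqnorm (a *: f) <= a ^+ 2 * sqnorm f.
Proof.
move=> Hf; have [->|a0] := eqVneq a 0.
  rewrite scale0r expr0n mul0r; apply: sqnorm_le => u.
  rewrite /energy /ev big1 => [|p _]; last by rewrite mulr0.
  by rewrite mulr0 sub0r oppr_le0 Kpsd.2.
apply: sqnorm_le => u.
have -> : energy (a *: f) u = a ^+ 2 * energy f (scl a^-1 u).
  have := ev_linear f 0 a 0 u; rewrite scale0r addr0 mul0r addr0 => E.
  by rewrite /energy E ev_scl gram_scll gram_sclr; field.
by rewrite ler_wpM2l ?sqr_ge0// energy_le.
Qed.

Lemma sqnormZ a f : in_rkhs f -> sqnorm (a *: f) = a ^+ 2 * sqnorm f.
Proof.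
move=> Hf; apply/eqP; rewrite eq_le sqnorm_scale_le//=.
have [->|a0] := eqVneq a 0.
  by rewrite expr0n mul0r scale0r sqnorm_ge0//; exact: in_rkhs0.
have := sqnorm_scale_le a^-1 (in_rkhsZ a Hf).
by rewrite scalerA mulVf// scale1r exprVn ler_pdivlMl ?exprn_even_gt0.
Qed.

(** The reverse inequality is the direct one applied to the rotated pair with [- b] for [b]: this
    rotates back to the original pair, multiplied by a^2 + b^2. *)
Lemma sqnorm_rotate f g a b : b != 0 -> in_rkhs f -> in_rkhs g ->
  sqnorm (a *: f + b *: g) + sqnorm (a *: g - b *: f) =
  (a ^+ 2 + b ^+ 2) * (sqnorm f + sqnorm g).
Proof.
move=> b0 Hf Hg; have s0 := sqr_sum_gt0 a b0.
apply/eqP; rewrite eq_le sqnorm_rotate_le//=.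
set f' := a *: f + b *: g; set g' := a *: g - b *: f.
have Hf' : in_rkhs f' by exact: in_rkhsP.
have Hg' : in_rkhs g' by apply: in_rkhsB; exact: in_rkhsZ.
have Nb0 : - b != 0 by rewrite oppr_eq0.
have := sqnorm_rotate_le a Nb0 Hf' Hg'.
have -> : a *: f' + (- b) *: g' = (a ^+ 2 + b ^+ 2) *: f.
  have E (r s : R) :
    a * (a * r + b * s) + - b * (a * s - b * r) = (a ^+ 2 + b ^+ 2) * r by ring.
  by apply/funext => x; exact: E.
have -> : a *: g' - (- b) *: f' = (a ^+ 2 + b ^+ 2) *: g.
  have E (r s : R) :
    a * (a * s - b * r) - - b * (a * r + b * s) = (a ^+ 2 + b ^+ 2) * s by ring.
  by apply/funext => x; exact: E.
rewrite !sqnormZ// -mulrDr sqrrN expr2 -mulrA ler_pM2l//.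
Qed.

Lemma sqnorm0 : sqnorm 0 = 0.
Proof. by rewrite -(scale0r 0) sqnormZ ?expr0n ?mul0r//; exact: in_rkhs0. Qed.

Lemma sqnormN f : in_rkhs f -> sqnorm (- f) = sqnorm f.
Proof. by move=> Hf; rewrite -scaleN1r sqnormZ// sqrrN expr1n mul1r. Qed.

Definition form f g : R := (sqnorm (f + g) - sqnorm f - sqnorm g) / 2.

Lemma formC f g : form f g = form g f.
Proof. by rewrite /form [g + f]addrC; ring. Qed.

Lemma formff f : in_rkhs f -> form f f = sqnorm f.
Proof.
by move=> Hf; rewrite /form -mulr2n -scaler_nat sqnormZ//; field.
Qed.

Lemma sqnormD f g : sqnorm (f + g) = sqnorm f + sqnorm g + 2 * form f g.
Proof. by rewrite /form; field. Qed.

Lemma parallelogram f g : in_rkhs f -> in_rkhs g ->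
  sqnorm (f + g) + sqnorm (f - g) = 2 * (sqnorm f + sqnorm g).
Proof.
move=> Hf Hg; have := sqnorm_rotate 1 (oner_neq0 R) Hf Hg.
rewrite !scale1r expr1n => <-; congr (_ + _).
by rewrite -opprB -scaleN1r sqnormZ ?sqrrN ?expr1n ?mul1r//; exact: in_rkhsB.
Qed.

(** The Jordan-von Neumann argument: additivity is a linear combination of four instances of the
    parallelogram law. *)
Lemma formDl f g h : in_rkhs f -> in_rkhs g -> in_rkhs h ->
  form (f + g) h = form f h + form g h.
Proof.
move=> Hf Hg Hh.
have E1 := parallelogram (in_rkhsD Hf Hh) Hg.
have E2 := parallelogram (in_rkhsD Hg Hh) Hf.
have E3 := parallelogram Hh (in_rkhsB Hf Hg).
have E4 := parallelogram Hf Hg.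
move: E1 E2 E3; rewrite /form.
have -> : f + h + g = f + g + h by rewrite addrAC.
have -> : g + h + f = f + g + h by rewrite addrC addrA.
have -> : f + h - g = h + (f - g) by rewrite addrAC addrC.
have -> : g + h - f = h - (f - g) by rewrite opprB addrA [h + g]addrC.
by move=> E1 E2 E3; lra.
Qed.

Lemma formNl f g : in_rkhs f -> in_rkhs g -> form (- f) g = - form f g.
Proof.
move=> Hf Hg; have := formDl Hf (in_rkhsN Hf) Hg.
have Z : form 0 g = 0.
  by rewrite /form add0r sqnorm0; ring.
by rewrite subrr Z => /esym/eqP; rewrite addrC addr_eq0 => /eqP.
Qed.

(* The rotation identity for (a, 1) reads [form (a f) g = form f (a g)], so that
   a |-> form (a f) g is additive and agrees with a linear map on squares. *)
Lemma formZ_swap a f g : in_rkhs f -> in_rkhs g ->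
  form (a *: f) g = form f (a *: g).
Proof.
move=> Hf Hg; have Hag := in_rkhsZ a Hg.
have := sqnorm_rotate a (oner_neq0 R) Hf Hg.
rewrite !scale1r expr1n !sqnormD !sqnormN// !sqnormZ//.
by rewrite [form _ (- f)]formC formNl// => ?; lra.
Qed.

Lemma form_sqrZ a f g : in_rkhs f -> in_rkhs g ->
  form (a ^+ 2 *: f) g = a ^+ 2 * form f g.
Proof.
move=> Hf Hg; rewrite expr2 -scalerA formZ_swap//; last exact: in_rkhsZ.
rewrite {1}/form -scalerDr !sqnormZ//; last exact: in_rkhsD.
by rewrite /form; field.
Qed.

Lemma formZl a f g : in_rkhs f -> in_rkhs g -> form (a *: f) g = a * form f g.
Proof.
move=> Hf Hg.
have E : 2 * form (a *: f) g = 2 * a * form f g.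
  have H2 : form (a *: f + a *: f) g = 2 * form (a *: f) g.
    by rewrite formDl//; [ring|exact: in_rkhsZ..].
  (* Since 2 a = (a + 1)^2 - a^2 - 1, additivity and the case of squares give every scalar, with no
     continuity argument. *)
  have := form_sqrZ (a + 1) Hf Hg; have := form_sqrZ a Hf Hg.
  have -> : (a + 1) ^+ 2 *: f = a ^+ 2 *: f + (a *: f + a *: f) + f.
    have -> : (a + 1) ^+ 2 = a ^+ 2 + (a + a) + 1 by ring.
    by rewrite !scalerDl scale1r.
  rewrite formDl//; last first.
    by do 2?[apply: in_rkhsD|apply: in_rkhsZ] => //; exact: in_rkhsZ.
  rewrite formDl//; [|by do 2?[apply: in_rkhsD|apply: in_rkhsZ]..].
  by rewrite H2 => -> E; lra.
by lra.
Qed.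

Definition kcomb u : X -> R := fun x => ev (K x) u.

Lemma ev_kcomb u v : ev (kcomb u) v = gram K v u.
Proof. by []. Qed.

Lemma energy_subK f u v :
  energy (f - kcomb u) v = energy f (u ++ v) - energy f u.
Proof.
rewrite /energy -[f]scale1r -scaleN1r ev_linear ev_kcomb !scale1r ev_cat.
by rewrite !gram_catl !gram_catr (gram_sym u v Ksym); ring.
Qed.

(** Completing the square: [energy f u] is |f|^2 - |f - k_u|^2, where k_u is [kcomb u]. The case f =
    0 puts k_u itself in the space. *)
Lemma sqnorm_subK f u : in_rkhs f ->
  in_rkhs (f - kcomb u) /\ sqnorm (f - kcomb u) = sqnorm f - energy f u.
Proof.
move=> Hf; have Hfu : in_rkhs (f - kcomb u).
  exists (sqnorm f - energy f u) => v.
  by rewrite energy_subK lerD2r energy_le.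
split=> //; apply/eqP; rewrite eq_le; apply/andP; split.
  by apply: sqnorm_le => v; rewrite energy_subK lerD2r energy_le.
rewrite lerBlDr; apply: sqnorm_le => v; rewrite -lerBlDr.
(* The measure - u cancels the [u] added by [energy_subK], so the supremum over the shifted measures
   is the full one. *)
have := energy_le (scl (-1) u ++ v) Hfu; congr (_ <= _).
rewrite energy_subK; congr (_ - _).
rewrite /energy !ev_cat !gram_catl !gram_catr !gram_scll !gram_sclr !ev_scl.
by rewrite (gram_sym u v Ksym); ring.
Qed.

Lemma in_rkhs_kcomb u : in_rkhs (kcomb u).
Proof.
have [] := sqnorm_subK u in_rkhs0; rewrite sub0r => /in_rkhsN.
by rewrite opprK.
Qed.

Lemma sqnorm_kcomb u : sqnorm (kcomb u) = gram K u u.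
Proof.
have [Hu] := sqnorm_subK u (in_rkhs_kcomb u).
rewrite subrr sqnorm0 => /eqP.
by rewrite eq_sym subr_eq0 => /eqP ->; rewrite /energy ev_kcomb; ring.
Qed.

(** By [sqnorm_subK], a near maximizer of the energy is a good approximation. *)
Lemma rkhs_dense f (e : R) : in_rkhs f -> 0 < e ->
  exists u, sqnorm (f - kcomb u) < e.
Proof.
move=> Hf e0.
have [_ [u _ <-] fu] : exists2 y, range (energy f) y & sqnorm f - e < y.
  apply: sup_adherent => //; split.
    by exists (energy f [::]); exists [::].
  by exists (sqnorm f) => _ [u _ <-]; exact: energy_le.
by exists u; rewrite (sqnorm_subK u Hf).2 ltrBlDr -ltrBlDl.
Qed.

(** Cauchy-Schwarz for evaluation at x, read off the energies of the one-point measures t at x. *)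
Lemma rkhs_eval_le f x : in_rkhs f -> f x ^+ 2 <= sqnorm f * K x x.
Proof.
move=> Hf; rewrite -sqrrN mulrC.
apply: discriminant_le; first exact: psd_diag_ge0.
move=> t; have := energy_le [:: (t, x)] Hf.
by rewrite /energy gram1 ev_cons ev_nil /= => ?; lra.
Qed.

Lemma sqnorm_eq0 f : in_rkhs f -> sqnorm f = 0 -> f = 0.
Proof.
move=> Hf f0; apply/funext => x; have := rkhs_eval_le x Hf.
by rewrite f0 mul0r => ?; apply/eqP; rewrite -sqrf_eq0 eq_le sqr_ge0 andbT.
Qed.

End real_rkhs.

(** Lower semicontinuity: each energy depends on finitely many values of the function, and a
    supremum inherits the bounds on its members. *)
Lemma sqnorm_lim (R : realType) (X : Type) (K : X -> X -> R) (T : Type)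
    (F : set_system T) (FF : ProperFilter F) (fn : T -> X -> R) f M :
    (forall x, fn t x @[t --> F] --> f x) ->
    (\forall t \near F, in_rkhs K (fn t) /\ sqnorm K (fn t) <= M) ->
  in_rkhs K f /\ sqnorm K f <= M.
Proof.
move=> fnf fnM; have fM u : energy K f u <= M.
  have ecvg : energy K (fn t) u @[t --> F] --> energy K f u.
    apply: cvgB; last exact: cvg_cst.
    by apply: cvgM; [exact: cvg_cst|exact: cvg_ev].
  apply: cvgr_to_le ecvg _; apply: filterS fnM => t [Ht].
  by apply: le_trans; exact: energy_le.
by split; [exists M|exact: sqnorm_le].
Qed.

(** Bundling the positivity proof lets the structures on the type [rkhs K] recover it from [K]. *)
Record psd_kernel (R : realType) (X : Type) :=
  PsdKernel { kernel_fun :> X -> X -> R; kernel_psd : psd kernel_fun }.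

(** * The complex Hilbert space of a real kernel *)

Section rkhs.
Variables (R : realType) (X : Type) (K : psd_kernel R X).
Implicit Types f g : X -> R[i].
Local Open Scope complex_scope.

Let Kpsd := kernel_psd K.

Definition cre f : X -> R := fun x => complex.Re (f x).
Definition cim f : X -> R := fun x => complex.Im (f x).

Lemma creP (a : R[i]) f g : cre (a *: f + g) =
  complex.Re a *: cre f - complex.Im a *: cim f + cre g.
Proof.
apply/funext => x; rewrite /cre /cim.
by case: a => a1 a2; rewrite !fctE /=; case: (f x) (g x) => [f1 f2] [g1 g2].
Qed.

Lemma cimP (a : R[i]) f g : cim (a *: f + g) =
  complex.Re a *: cim f + complex.Im a *: cre f + cim g.
Proof.
apply/funext => x; rewrite /cre /cim.
by case: a => a1 a2; rewrite !fctE /=; case: (f x) (g x) => [f1 f2] [g1 g2].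
Qed.

Lemma cre0 : cre 0 = 0. Proof. by []. Qed.
Lemma cim0 : cim 0 = 0. Proof. by []. Qed.

Lemma creB f g : cre (f - g) = cre f - cre g.
Proof.
by apply/funext => x; rewrite /cre !fctE; case: (f x) (g x) => [? ?] [].
Qed.

Lemma cimB f g : cim (f - g) = cim f - cim g.
Proof.
by apply/funext => x; rewrite /cim !fctE; case: (f x) (g x) => [? ?] [].
Qed.

(** The kernel being real, its complex space is the complexification of the real one; [cform] is the
    sesquilinear extension of [form]. *)
Definition rkhs_pred : {pred X -> R[i]} :=
  fun f => `[< in_rkhs K (cre f) /\ in_rkhs K (cim f) >].

Lemma rkhs_submod_closed : submod_closed rkhs_pred.
Proof.
split; first by apply/asboolP; rewrite cre0 cim0; split; exact: in_rkhs0.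
move=> a f g /asboolP[fr fi] /asboolP[gr gi]; apply/asboolP.
rewrite creP cimP; split.
  by apply: in_rkhsD => //; apply: in_rkhsB => //; exact: in_rkhsZ.
by apply: in_rkhsD => //; apply: in_rkhsD => //; exact: in_rkhsZ.
Qed.

HB.instance Definition _ :=
  GRing.isSubmodClosed.Build _ _ rkhs_pred rkhs_submod_closed.

Record rkhs := Rkhs { rkhs_fun :> X -> R[i]; _ : rkhs_fun \in rkhs_pred }.

HB.instance Definition _ := [isSub for rkhs_fun].
HB.instance Definition _ := [Choice of rkhs by <:].
HB.instance Definition _ := [SubChoice_isSubLmodule of rkhs by <:].

Implicit Types h k : rkhs.

Lemma rkhs_re h : in_rkhs K (cre h).
Proof. by case: h => f /= /asboolP[]. Qed.

Lemma rkhs_im h : in_rkhs K (cim h).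
Proof. by case: h => f /= /asboolP[]. Qed.

Hint Resolve rkhs_re rkhs_im : core.

Lemma rkhs_funP (a : R[i]) h k :
  (a *: h + k : rkhs) = a *: (h : X -> R[i]) + k :> (X -> R[i]).
Proof. by []. Qed.

Lemma rkhs_funB h k : (h - k : rkhs) = (h : X -> R[i]) - k :> (X -> R[i]).
Proof. by []. Qed.

Definition csqnorm h : R := sqnorm K (cre h) + sqnorm K (cim h).

Definition cform h k : R[i] :=
  (form K (cre h) (cre k) + form K (cim h) (cim k)) +i*
  (form K (cim h) (cre k) - form K (cre h) (cim k)).

Lemma csqnorm_ge0 h : 0 <= csqnorm h.
Proof. by rewrite addr_ge0// sqnorm_ge0. Qed.

Lemma cformff h : cform h h = (csqnorm h)%:C.
Proof. by rewrite /cform !formff// [form _ (cim h) _]formC subrr. Qed.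

Lemma cform_linearl k (a : R[i]) h h' :
  cform (a *: h + h') k = a * cform h k + cform h' k.
Proof.
rewrite /cform rkhs_funP creP cimP.
rewrite !(formDl, formNl, formZl)//;
  try by do ?[exact: rkhs_re|exact: rkhs_im|apply: in_rkhsZ|apply: in_rkhsN
              |apply: in_rkhsD].
by case: a => a1 a2 /=; congr (_ +i* _) => /=; ring.
Qed.

Lemma cformC h k : cform h k = Num.Def.conjC (cform k h).
Proof.
rewrite /cform; congr (_ +i* _); rewrite ?opprB; do 2 ?[congr (_ + _)];
  by rewrite formC.
Qed.

Lemma cform_linearr h (a : R[i]) k k' :
  cform h (a *: k + k') = Num.Def.conjC a * cform h k + cform h k'.
Proof. by rewrite cformC cform_linearl rmorphD rmorphM /= -!cformC. Qed.

Lemma cform0l k : cform 0 k = 0.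
Proof.
by have := cform_linearl k (-1) 0 0; rewrite scaler0 add0r mulN1r addNr.
Qed.

Lemma cform0 h : cform h 0 = 0.
Proof. by rewrite cformC cform0l rmorph0. Qed.

Definition cnorm h : R[i] := (Num.sqrt (csqnorm h))%:C.

Lemma csqnormD h k : csqnorm (h + k) =
  csqnorm h + csqnorm k + 2 * complex.Re (cform h k).
Proof.
rewrite /csqnorm -[h]scale1r rkhs_funP creP cimP /= !scale1r !scale0r subr0.
by rewrite addr0 !sqnormD; ring.
Qed.

(** Cauchy-Schwarz for the real part only, which is all that the triangle inequality asks for. *)
Lemma cform_Re_le h k : complex.Re (cform h k) ^+ 2 <= csqnorm h * csqnorm k.
Proof.
apply: discriminant_le; first exact: csqnorm_ge0.
move=> t; have := csqnorm_ge0 (t%:C *: h + k).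
suff -> : csqnorm (t%:C *: h + k) =
    t ^+ 2 * csqnorm h + 2 * t * complex.Re (cform h k) + csqnorm k by [].
have E : csqnorm (t%:C *: h) = t ^+ 2 * csqnorm h.
  rewrite /csqnorm -[t%:C *: h]addr0 rkhs_funP creP cimP /= !scale0r.
  by rewrite !(subr0, addr0) !sqnormZ// mulrDr.
rewrite csqnormD E -[t%:C *: h]addr0 cform_linearl.
by rewrite cform0l addr0 /=; ring.
Qed.

Lemma ler_cnormD h k : cnorm (h + k) <= cnorm h + cnorm k.
Proof.
rewrite /cnorm -rmorphD lecR -(@ler_pXn2r _ 2)// ?nnegrE ?addr_ge0 ?sqrtr_ge0//.
rewrite sqrrD !sqr_sqrtr ?csqnorm_ge0// csqnormD.
suff : complex.Re (cform h k) <= Num.sqrt (csqnorm h) * Num.sqrt (csqnorm k).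
  by move=> ?; lra.
rewrite -sqrtrM ?csqnorm_ge0//; apply: le_trans (ler_norm _) _.
by rewrite -sqrtr_sqr ler_wsqrtr// cform_Re_le.
Qed.

Lemma cnorm_ge0 h : 0 <= cnorm h.
Proof. by rewrite ler0c sqrtr_ge0. Qed.

Lemma cnorm_sqr h : cnorm h ^+ 2 = (csqnorm h)%:C.
Proof. by rewrite -rmorphXn sqr_sqrtr// csqnorm_ge0. Qed.

Lemma cnormZ (a : R[i]) h : cnorm (a *: h) = `|a| * cnorm h.
Proof.
apply/eqP; rewrite -(@eqrXn2 _ 2) ?mulr_ge0 ?cnorm_ge0//.
rewrite exprMn !cnorm_sqr normCK -!cformff -[a *: h]addr0.
by rewrite cform_linearl cform_linearr cform0l !cform0 !addr0 mulrA.
Qed.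

Lemma cnorm_eq0 h : cnorm h = 0 -> h = 0.
Proof.
move=> /complexI/eqP; rewrite sqrtr_eq0 => h0.
have r0 := sqnorm_ge0 (rkhs_re h); have i0 := sqnorm_ge0 (rkhs_im h).
have hr : cre h = 0.
  by apply: (sqnorm_eq0 Kpsd) => //; move: h0; rewrite /csqnorm; lra.
have hi : cim h = 0.
  by apply: (sqnorm_eq0 Kpsd) => //; move: h0; rewrite /csqnorm; lra.
apply/val_inj/funext => x /=.
have := congr1 (@^~ x) hr; have := congr1 (@^~ x) hi; rewrite /cre /cim.
by case: (h x) => a b /= -> ->.
Qed.

HB.instance Definition _ :=
  @Lmodule_isNormed.Build R[i] rkhs cnorm ler_cnormD cnormZ cnorm_eq0.

Lemma rkhs_normE h : `|h| = (Num.sqrt (csqnorm h))%:C.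
Proof. by []. Qed.

Lemma rkhs_norm_le h (e : R) : 0 <= e ->
  (`|h| <= e%:C) = (csqnorm h <= e ^+ 2).
Proof.
move=> e0; rewrite rkhs_normE lecR -(@ler_pXn2r _ 2)// ?nnegrE ?sqrtr_ge0//.
by rewrite sqr_sqrtr ?csqnorm_ge0.
Qed.

(** Evaluations are bounded, so a Cauchy filter converges pointwise; lower semicontinuity of the
    norm turns this into convergence in norm. *)
Lemma rkhs_complete (F : set_system rkhs) :
  ProperFilter F -> cauchy F -> cvg F.
Proof.
move=> FF /cauchy_ballP Fc.
have Fs e : 0 < e -> \forall h \near F, \forall k \near F, csqnorm (h - k) <= e.
  move=> e0; have s0 : 0 < (Num.sqrt e)%:C by rewrite ltcR sqrtr_gt0.
  apply: nearP_dep; have := Fc _ s0; apply: filterS => -[h k] /=.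
  rewrite -ball_normE /= => /ltW.
  by rewrite rkhs_norm_le ?sqrtr_ge0// sqr_sqrtr ?(ltW e0).
have eval_cvg (c : (X -> R[i]) -> X -> R) x :
    (forall f g, c (f - g) = c f - c g) ->
    (forall h, in_rkhs K (c h) /\ sqnorm K (c h) <= csqnorm h) ->
    cvg ((c h : X -> R) x @[h --> F]).
  move=> cB cle; apply: cauchy_cvg; apply: cauchy_exP => e e0.
  (* [rkhs_eval_le] multiplies squared distances by [K x x]; the 1 covers [K x x = 0] and the factor
     2 makes the final bound strict. *)
  have d0 : 0 < e ^+ 2 / (K x x + 1) / 2.
    by rewrite !divr_gt0 ?exprn_gt0// ltr_wpDl// psd_diag_ge0.
  have /filter_ex[h hk] := Fs _ d0; exists (c h x).
  apply: filterS hk => k hk; rewrite -ball_normE /=.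
  have [Hc cn] := cle (h - k); have := rkhs_eval_le Kpsd x Hc.
  rewrite cB => le1; rewrite -(@ltr_pXn2r _ 2) ?nnegrE ?(ltW e0)//.
  rewrite real_normK ?num_real//; apply: le_lt_trans le1 _.
  have K0 := psd_diag_ge0 Kpsd x.
  apply: (@le_lt_trans _ _ (e ^+ 2 / (K x x + 1) / 2 * (K x x + 1))).
    apply: ler_pM => //; last by rewrite lerDl.
      by rewrite -cB; exact: sqnorm_ge0.
    by rewrite -cB; apply: le_trans cn hk.
  rewrite mulrAC divfK; last by rewrite gt_eqF// ltr_wpDl.
  by rewrite ltr_pdivrMr// ltr_pMr ?exprn_gt0// ltr1n.
have csq_re h : in_rkhs K (cre h) /\ sqnorm K (cre h) <= csqnorm h.
  by split=> //; rewrite lerDl sqnorm_ge0.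
have csq_im h : in_rkhs K (cim h) /\ sqnorm K (cim h) <= csqnorm h.
  by split=> //; rewrite lerDr sqnorm_ge0.
have cvg_re x := eval_cvg cre x creB csq_re.
have cvg_im x := eval_cvg cim x cimB csq_im.
pose f0 : X -> R[i] := fun x =>
  lim (cre h x @[h --> F]) +i* lim (cim h x @[h --> F]).
(* With [h] fixed and [k] running along [F], the bound on [h - k] passes to the pointwise limit
   [f0]. This gives both the membership of [f0] and the convergence to it. *)
have lim_le h e : (\forall k \near F, csqnorm (h - k) <= e) ->
  [/\ in_rkhs K (cre h - cre f0), sqnorm K (cre h - cre f0) <= e,
      in_rkhs K (cim h - cim f0) & sqnorm K (cim h - cim f0) <= e].
  move=> hk.
  have [||r1 r2] := @sqnorm_lim _ _ K _ F FF (fun k => cre h - cre k)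
      (cre h - cre f0) e.
  - by move=> x; apply: cvgB; [exact: cvg_cst|exact: cvg_re].
  - apply: filterS hk => k hk; rewrite -creB; have [? le1] := csq_re (h - k).
    by split=> //; exact: le_trans le1 hk.
  have [||i1 i2] := @sqnorm_lim _ _ K _ F FF (fun k => cim h - cim k)
      (cim h - cim f0) e.
  - by move=> x; apply: cvgB; [exact: cvg_cst|exact: cvg_im].
  - apply: filterS hk => k hk; rewrite -cimB; have [? le1] := csq_im (h - k).
    by split=> //; exact: le_trans le1 hk.
  by [].
have f0P : f0 \in rkhs_pred.
  have /filter_ex[h /lim_le[r1 _ i1 _]] := Fs _ ltr01.
  apply/asboolP; split.
    by rewrite -[cre f0](subKr (cre h)); exact: in_rkhsB.
  by rewrite -[cim f0](subKr (cim h)); exact: in_rkhsB.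
apply/cvg_ex; exists (Rkhs f0P); apply/cvgrPdist_le => e e0.
have [r r0 ->] : exists2 r, 0 < r & e = r%:C.
  case: e e0 => a b; rewrite ltcE /= => /andP[/eqP -> a0].
  by exists a => //; rewrite complexr0.
have r2 : 0 < r ^+ 2 / 2 by rewrite divr_gt0 ?exprn_gt0.
apply: filterS (Fs _ r2) => h /lim_le[_ r1 _ i1].
rewrite distrC rkhs_norm_le ?(ltW r0)// /csqnorm rkhs_funB creB cimB.
by rewrite [leRHS]splitr lerD.
Qed.

HB.instance Definition _ := Uniform_isComplete.Build rkhs rkhs_complete.

Lemma cform_bilinear :
  bilinear_for *%R (Num.Def.conjC \; *%R) cform.
Proof.
split=> [k a h h'|h a k k']; first exact: cform_linearl.
exact: cform_linearr.
Qed.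

HB.instance Definition _ := bilinear_isBilinear.Build R[i] rkhs rkhs R[i]
  *%R (Num.Def.conjC \; *%R) cform cform_bilinear.

Lemma cform_hermitian h k :
  cform h k = (-1) ^+ false * Num.Def.conjC (cform k h).
Proof. by rewrite expr0 mul1r -cformC. Qed.

HB.instance Definition _ := isHermitianSesquilinear.Build R[i] rkhs false
  Num.Def.conjC cform cform_hermitian.

Lemma cform_gt0 h : h != 0 -> 0 < cform h h.
Proof.
rewrite cformff ltcR lt_neqAle csqnorm_ge0 andbT; apply: contraNneq => h0.
by apply/eqP/cnorm_eq0; rewrite /cnorm -h0 sqrtr0.
Qed.

HB.instance Definition _ := isDotProduct.Build R[i] rkhs cform cform_gt0.

Lemma rkhs_sqr_normE h : `|h| ^+ 2 = cform h h.
Proof. by rewrite cformff -cnorm_sqr. Qed.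

HB.instance Definition _ :=
  CompleteNormedModule_isHilbert.Build R rkhs rkhs_sqr_normE.

End rkhs.

(** * The affine action of a conditionally negative definite function *)

Section affine_action.
Variables (R : realType) (G : topologicalGroupType) (psi : G -> R).
Implicit Types (f : G -> R) (u : seq (R * G)).

(** Positivity of this kernel is how the file expresses that [psi] is conditionally of negative
    type. It is twice the Gromov product at 1 of [psi (x^-1 * y)], which explains the factor in
    |b|^2 = 2 psi. *)
Definition gromov_kernel x y : R := psi x + psi y - psi (x^-1 * y)%g.

Hypotheses (psi1 : psi 1%g = 0) (Kpsd : psd gromov_kernel).
Hypothesis psi_continuous : continuous psi.
Local Notation K := gromov_kernel.

Lemma psi_inv x : psi x^-1%g = psi x.
Proof.
have := Kpsd.1 1%g x.
by rewrite /gromov_kernel invg1 mul1g mulg1 => ?; lra.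
Qed.

(** As [K] vanishes at 1, so does every function of the space; the subtracted constant restores this
    after left translation. *)
Definition translate (g : G) f : G -> R :=
  fun x => f (g^-1 * x)%g - f g^-1%g.

(** The transpose of [translate g]: push the measure forward by g^-1, then remove its total mass at
    g^-1. *)
Definition comb_translate (g : G) u : seq (R * G) :=
  (- \sum_(p <- u) p.1, g^-1%g) :: [seq (p.1, (g^-1 * p.2)%g) | p <- u].

Lemma ev_translate g f u : ev (translate g f) u = ev f (comb_translate g u).
Proof.
rewrite /comb_translate ev_cons /= addrC mulNr mulr_suml /ev big_map -sumrB.
by apply: eq_bigr => p _; rewrite /translate mulrBr.
Qed.

(** [comb_translate g u] is the translate by g^-1 of [u] minus its mass at 1. It has total mass 0,
    and on such measures [gram K] is minus the double integral of psi(x^-1 y), which is left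
    invariant. The mass at 1 is invisible to [K]. *)
Lemma gram_translate g u :
  gram K (comb_translate g u) (comb_translate g u) = gram K u u.
Proof.
rewrite {1}/gram -ev_translate; apply: ev_ext => y.
rewrite /translate -!ev_translate /ev -sumrB; apply: eq_bigr => p _.
rewrite -mulrBr; congr (_ * _); rewrite /translate /gromov_kernel.
rewrite !invgM !invgK !mulgA mulgK mulgV mul1g psi1.
by rewrite !psi_inv; ring.
Qed.

Lemma energy_translate g f u :
  energy K (translate g f) u = energy K f (comb_translate g u).
Proof. by rewrite /energy ev_translate gram_translate. Qed.

Lemma in_rkhs_translate g f : in_rkhs K f -> in_rkhs K (translate g f).
Proof. by move=> [M fM]; exists M => u; rewrite energy_translate. Qed.

Lemma rkhs_at1 f : in_rkhs K f -> f 1%g = 0.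
Proof.
move=> /(rkhs_eval_le Kpsd 1%g).
rewrite /gromov_kernel mulg1 invg1 psi1 addr0 subr0 mulr0 => f1.
by apply/eqP; rewrite -sqrf_eq0 eq_le f1 sqr_ge0.
Qed.

Lemma translateM g h f : translate (g * h)%g f = translate g (translate h f).
Proof.
by apply/funext => x; rewrite /translate invgM mulgA; ring.
Qed.

Lemma translate1 f : in_rkhs K f -> translate 1%g f = f.
Proof.
move=> /rkhs_at1 f1; apply/funext => x.
by rewrite /translate invg1 mul1g f1 subr0.
Qed.

Lemma sqnorm_translate g f : in_rkhs K f ->
  sqnorm K (translate g f) = sqnorm K f.
Proof.
have le1 g' f' : in_rkhs K f' -> sqnorm K (translate g' f') <= sqnorm K f'.
  move=> Hf'; apply: sqnorm_le => u; rewrite energy_translate.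
  exact: energy_le.
move=> Hf; apply/eqP; rewrite eq_le le1//=.
have := le1 g^-1%g _ (in_rkhs_translate g Hf).
by rewrite -translateM mulVg translate1.
Qed.

Lemma translateP g (a : R) f f' :
  translate g (a *: f + f') = a *: translate g f + translate g f'.
Proof.
have E (x y z t : R) : a * x + y - (a * z + t) = a * (x - z) + (y - t) by ring.
by apply/funext => x; exact: E.
Qed.

Lemma translateD g f f' : translate g (f + f') = translate g f + translate g f'.
Proof. by rewrite -[f]scale1r translateP !scale1r. Qed.

Lemma form_translate g f f' : in_rkhs K f -> in_rkhs K f' ->
  form K (translate g f) (translate g f') = form K f f'.
Proof.
move=> Hf Hf'; rewrite /form -translateD !sqnorm_translate//.
exact: in_rkhsD.
Qed.

Definition kernel_at x : G -> R := K^~ x.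

Lemma kernel_atE x : kernel_at x = kcomb K [:: (1, x)].
Proof.
by apply/funext => y; rewrite /kernel_at /kcomb ev_cons ev_nil mul1r addr0.
Qed.

Lemma in_rkhs_kernel_at x : in_rkhs K (kernel_at x).
Proof. by rewrite kernel_atE; exact: in_rkhs_kcomb. Qed.

Lemma sqnorm_kernel_at x : sqnorm K (kernel_at x) = 2 * psi x.
Proof.
rewrite kernel_atE sqnorm_kcomb// gram1 /gromov_kernel mulVg psi1; ring.
Qed.

(** The cocycle relation b(gx) = pi(g) b(x) + b(g) for b = [kernel_at]. *)
Lemma translate_kernel_at g x :
  translate g (kernel_at x) = kernel_at (g * x)%g - kernel_at g.
Proof.
apply/funext => y; rewrite /translate /kernel_at /gromov_kernel !fctE.
rewrite -[psi (g^-1 * y)%g]psi_inv !invgM !invgK -(mulgA y^-1%g g x) psi_inv.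
ring.
Qed.

Lemma sqnorm_kernel_atB x y :
  sqnorm K (kernel_at x - kernel_at y) = 2 * psi (x^-1 * y)%g.
Proof.
rewrite -opprB sqnormN//; last first.
  by apply: in_rkhsB => //; exact: in_rkhs_kernel_at.
rewrite -{1}(mulVKg x y) -translate_kernel_at sqnorm_translate.
  exact: sqnorm_kernel_at.
exact: in_rkhs_kernel_at.
Qed.

Lemma sqnormD_le2 f f' : in_rkhs K f -> in_rkhs K f' ->
  sqnorm K (f + f') <= 2 * (sqnorm K f + sqnorm K f').
Proof.
move=> Hf Hf'; rewrite -(parallelogram Kpsd Hf Hf') lerDl sqnorm_ge0//.
exact: in_rkhsB.
Qed.

Lemma cvg_sqnorm_kernel_at x (e : R) : 0 < e ->
  \forall y \near x, sqnorm K (kernel_at x - kernel_at y) <= e.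
Proof.
move=> e0; have d0 : 0 < e / 2 by rewrite divr_gt0.
have psix : psi (x^-1 * y)%g @[y --> x] --> 0.
  rewrite -psi1 -(mulVg x).
  apply: (@continuous_comp _ _ _ (fun y => x^-1 * y)%g psi); last first.
    exact: psi_continuous.
  apply: (@continuous_comp _ _ _ (fun y => (x^-1, y)%g) (fun p => p.1 * p.2)%g).
    by apply: cvg_pair; [exact: cvg_cst|exact: cvg_id].
  exact: mulg_continuous.
have /cvgrPdist_le/(_ _ d0) := psix.
apply: filterS => y; rewrite sub0r normrN sqnorm_kernel_atB => le1.
have := ler_norm (psi (x^-1 * y)%g); lra.
Qed.

Lemma in_rkhs_translateB g g' f : in_rkhs K f ->
  in_rkhs K (translate g f - translate g' f).
Proof. by move=> Hf; apply: in_rkhsB => //; exact: in_rkhs_translate. Qed.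

Lemma cvg_translate_kcomb g u (e : R) : 0 < e ->
  \forall g' \near g,
    sqnorm K (translate g (kcomb K u) - translate g' (kcomb K u)) <= e.
Proof.
elim: u e => [|[a x] u IHu] e e0.
  have -> : kcomb K [::] = 0 by apply/funext => x; rewrite /kcomb ev_nil.
  have T0 h : translate h 0 = 0 by apply/funext => x; rewrite /translate subrr.
  by apply: nearW => h; rewrite !T0 subrr sqnorm0// ltW.
have -> : kcomb K ((a, x) :: u) = a *: kernel_at x + kcomb K u.
  by apply/funext => y; rewrite /kcomb ev_cons.
(* Two nested uses of [sqnormD_le2]: the inner one makes 4 e / (16 (a^2 + 1)), at most e / 4 after
   multiplication by a^2, and the outer one turns two terms e / 4 into e. The 1 covers a = 0. *)
have c0 : 0 < 16 * (a ^+ 2 + 1) by rewrite mulr_gt0// ltr_wpDl// sqr_ge0.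
have d0 : 0 < e / (16 * (a ^+ 2 + 1)) by rewrite divr_gt0.
have ex : \forall g' \near g,
    sqnorm K (kernel_at (g * x)%g - kernel_at (g' * x)%g) <=
    e / (16 * (a ^+ 2 + 1)).
  have gx : (g' * x)%g @[g' --> g] --> (g * x)%g.
    apply: (@continuous_comp _ _ _ (fun y => (y, x)) (fun p => p.1 * p.2)%g).
      by apply: cvg_pair; [exact: cvg_id|exact: cvg_cst].
    exact: mulg_continuous.
  exact: (gx _ (cvg_sqnorm_kernel_at (g * x)%g d0)).
have e4 : 0 < e / 4 by rewrite divr_gt0.
near=> g'; rewrite !translateP opprD addrACA -scalerBr.
have Hx : in_rkhs K (translate g (kernel_at x) - translate g' (kernel_at x)).
  exact/in_rkhs_translateB/in_rkhs_kernel_at.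
apply: le_trans (sqnormD_le2 (in_rkhsZ Kpsd a Hx)
  (in_rkhs_translateB _ _ (in_rkhs_kcomb Kpsd u))) _.
rewrite sqnormZ//.
have le1 :
    sqnorm K (translate g (kcomb K u) - translate g' (kcomb K u)) <= e / 4.
  by near: g'; exact: IHu.
have le2 : sqnorm K (kernel_at (g * x)%g - kernel_at (g' * x)%g) <=
    e / (16 * (a ^+ 2 + 1)) by near: g'.
have le3 : sqnorm K (kernel_at g - kernel_at g') <= e / (16 * (a ^+ 2 + 1)).
  by near: g'; exact: cvg_sqnorm_kernel_at.
have le4 : sqnorm K (translate g (kernel_at x) - translate g' (kernel_at x)) <=
    e / (4 * (a ^+ 2 + 1)).
  have E (k1 k2 k3 k4 : G -> R) : k1 - k2 - (k3 - k4) = k1 - k3 + - (k2 - k4).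
    by rewrite !opprB [k4 - k3]addrC addrACA [- k2 + k4]addrC.
  have Hkk z w : in_rkhs K (kernel_at z - kernel_at w).
    by apply: in_rkhsB => //; exact: in_rkhs_kernel_at.
  rewrite !translate_kernel_at E.
  apply: le_trans (sqnormD_le2 (Hkk _ _) (in_rkhsN Kpsd (Hkk _ _))) _.
  rewrite sqnormN//.
  have -> : e / (4 * (a ^+ 2 + 1)) = 4 * (e / (16 * (a ^+ 2 + 1))).
    by field; have := sqr_ge0 a; lra.
  lra.
have le5 : a ^+ 2 *
    sqnorm K (translate g (kernel_at x) - translate g' (kernel_at x)) <= e / 4.
  apply: le_trans (ler_wpM2l (sqr_ge0 a) le4) _.
  rewrite mulrA ler_pdivrMr ?mulr_gt0 ?ltr_wpDl ?sqr_ge0//.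
  have := sqr_ge0 a; nra.
lra.
Unshelve. all: by end_near. Qed.

(** Translations are isometric, so continuity on the dense set of kernel combinations suffices. The
    errors add up to 2 (2 (e/16 + e/16) + e/4) = e. *)
Lemma cvg_translate g f (e : R) : in_rkhs K f -> 0 < e ->
  \forall g' \near g, sqnorm K (translate g f - translate g' f) <= e.
Proof.
move=> Hf e0; have d0 : 0 < e / 16 by rewrite divr_gt0.
have [u fu] := rkhs_dense Kpsd Hf d0; set k := kcomb K u in fu.
have Hk : in_rkhs K k by exact: in_rkhs_kcomb.
have Hfk : in_rkhs K (f - k) by exact: in_rkhsB.
have e4 : 0 < e / 4 by rewrite divr_gt0.
apply: filterS (cvg_translate_kcomb g u e4) => g' le1.
have -> : translate g f - translate g' f =
    (translate g (f - k) + - translate g' (f - k)) +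
    (translate g k - translate g' k).
  by rewrite -[in LHS](subrK k f) !translateD opprD addrACA.
have [Hg Hg'] := (in_rkhs_translate g Hfk, in_rkhs_translate g' Hfk).
apply: le_trans
  (sqnormD_le2 (in_rkhsB Kpsd Hg Hg') (in_rkhs_translateB g g' Hk)) _.
have := sqnormD_le2 Hg (in_rkhsN Kpsd Hg').
rewrite sqnormN// !sqnorm_translate// => le2; lra.
Qed.

Local Open Scope complex_scope.

Let kernel : psd_kernel R G := PsdKernel Kpsd.
Local Notation H := (rkhs kernel).

Definition ctranslate (g : G) (h : G -> R[i]) : G -> R[i] :=
  fun x => h (g^-1 * x)%g - h g^-1%g.

Lemma cre_ctranslate g h : cre (ctranslate g h) = translate g (cre h).
Proof.
apply/funext => x; rewrite /cre /translate /ctranslate.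
by case: (h (g^-1 * x)%g) (h g^-1%g) => [? ?] [].
Qed.

Lemma cim_ctranslate g h : cim (ctranslate g h) = translate g (cim h).
Proof.
apply/funext => x; rewrite /cim /translate /ctranslate.
by case: (h (g^-1 * x)%g) (h g^-1%g) => [? ?] [].
Qed.

Lemma ctranslate_rkhs g (h : H) : ctranslate g h \in rkhs_pred kernel.
Proof.
apply/asboolP; rewrite cre_ctranslate cim_ctranslate.
by split; apply: in_rkhs_translate; [exact: rkhs_re|exact: rkhs_im].
Qed.

Definition rkhs_rep (g : G) (h : H) : H := Rkhs (ctranslate_rkhs g h).

Lemma ckernel_rkhs g : (fun x => (kernel_at g x)%:C) \in rkhs_pred kernel.
Proof.
apply/asboolP; split; first exact: in_rkhs_kernel_at.
exact: (in_rkhs0 Kpsd).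
Qed.

Definition rkhs_cocycle (g : G) : H := Rkhs (ckernel_rkhs g).

Lemma rkhs_repM g g' h : rkhs_rep (g * g')%g h = rkhs_rep g (rkhs_rep g' h).
Proof.
apply/val_inj/funext => x /=; rewrite /ctranslate invgM mulgA.
by rewrite opprB addrA subrK.
Qed.

Lemma rkhs_rep1 h : rkhs_rep 1%g h = h.
Proof.
apply/val_inj/funext => x /=; rewrite /ctranslate invg1 mul1g.
have := rkhs_at1 (rkhs_re h); have := rkhs_at1 (rkhs_im h).
rewrite /cre /cim; case: (h 1%g) => a b /= -> ->.
by rewrite subr0.
Qed.

Lemma rkhs_rep_unitary g : unitary (rkhs_rep g).
Proof.
split=> [a h h'|h h'|h].
- by apply/val_inj/funext => x; rewrite /= /ctranslate opprD addrACA scalerBr.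
- rewrite -[LHS]/(cform (rkhs_rep g h) (rkhs_rep g h')) -[RHS]/(cform h h').
  rewrite /cform !cre_ctranslate !cim_ctranslate.
  by rewrite !form_translate; try exact: rkhs_re; try exact: rkhs_im.
- by exists (rkhs_rep g^-1%g h); rewrite -rkhs_repM mulgV rkhs_rep1.
Qed.

Lemma rkhs_cvg (f : G -> H) g :
  (forall e : R, 0 < e -> \forall g' \near g, csqnorm (f g - f g') <= e) ->
  f g' @[g' --> g] --> f g.
Proof.
move=> fg; apply/cvgrPdist_le => e e0.
have [r r0 ->] : exists2 r, 0 < r & e = r%:C.
  case: e e0 => a b; rewrite ltcE /= => /andP[/eqP -> a0].
  by exists a => //; rewrite complexr0.
have r2 : 0 < r ^+ 2 by rewrite exprn_gt0.
by apply: filterS (fg _ r2) => g' ?; rewrite rkhs_norm_le// ltW.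
Qed.

Lemma rkhs_rep_continuous h : continuous (rkhs_rep ^~ h).
Proof.
move=> g; apply: rkhs_cvg => e e0; have e2 : 0 < e / 2 by rewrite divr_gt0.
apply: filterS2 (cvg_translate g (rkhs_re h) e2)
  (cvg_translate g (rkhs_im h) e2) => g' le1 le2.
rewrite /csqnorm rkhs_funB creB cimB !cre_ctranslate !cim_ctranslate.
by rewrite [leRHS]splitr lerD.
Qed.

Lemma rkhs_cocycle_continuous : continuous rkhs_cocycle.
Proof.
move=> g; apply: rkhs_cvg => e e0.
apply: filterS (cvg_sqnorm_kernel_at g e0) => g' le1.
rewrite /csqnorm rkhs_funB creB cimB [_ - cim _]subrr [sqnorm _ 0]sqnorm0//.
by rewrite addr0.
Qed.

Lemma rkhs_cocycleP : cocycle [set: G] rkhs_rep rkhs_cocycle.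
Proof.
split.
- split=> [g _|h|g g' _ _ h|h]; first exact: rkhs_rep_unitary.
  + exact: rkhs_rep1.
  + exact: rkhs_repM.
  + exact/continuous_subspaceT/rkhs_rep_continuous.
- exact/continuous_subspaceT/rkhs_cocycle_continuous.
- move=> g g' _ _; apply/val_inj/funext => x /=.
  have := congr1 (@^~ x) (translate_kernel_at g g').
  rewrite /translate !fctE => /eqP; rewrite eq_sym subr_eq => /eqP E.
  by rewrite E rmorphD rmorphB.
Qed.

Lemma hnorm_rkhs_cocycle g : hnorm (rkhs_cocycle g) = Num.sqrt (2 * psi g).
Proof.
rewrite /hnorm rkhs_normE /= /csqnorm [sqnorm _ (cim _)]sqnorm0// addr0.
by rewrite [sqnorm _ _]sqnorm_kernel_at.
Qed.

End affine_action.

(** * Proper length functions are locally bounded *)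

Section proper_length.
Variables (R : realType) (G : topologicalGroupType) (len : G -> R).
Hypotheses (Glc : locally_compact [set: G]) (Ght : hausdorff_space G).
Hypothesis lenP : proper_length_function len.

Lemma length_ball_closed r : closed [set g | len g <= r].
Proof. by apply: compact_closed => //; exact: lenP.2. Qed.

Lemma lc_nbhs_closure (x : G) (A : set G) : nbhs x A ->
  exists2 B, nbhs x B & closure B `<=` A.
Proof.
have [U] := @Glc x I; rewrite withinET => xU [cU _] xA.
exact: (compact_regular Ght cU xU xA).
Qed.

(* [len] is not assumed continuous: its local boundedness comes from a Baire
   category argument on its balls. *)
Lemma length_ball_nbhs :
  exists (n : nat) (x : G), nbhs x [set g | len g <= n%:R].
Proof.
apply: contrapT => noint.
have [U0] := @Glc 1%g I; rewrite withinET => U01 [cU0 _].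
(* A stage is a point with a neighbourhood of it; stage n + 1 has its closure inside the previous
   neighbourhood and off the ball of radius n. *)
pose P n (s t : G * set G) :=
  nbhs t.1 t.2 /\ closure t.2 `<=` s.2 `&` ~` [set g | len g <= n%:R].
have step (ns : nat * (G * set G)) :
    exists t, nbhs ns.2.1 ns.2.2 -> P ns.1 ns.2 t.
  case: ns => n [x U] /=; apply: contrapT => nt.
  have xU : nbhs x U by apply: contrapT => nxU; apply: nt; exists (x, U).
  apply: noint; exists n, x; apply: filterS (nbhs_interior xU) => y yU.
  rewrite /=; apply: contrapT => yn; apply: nt.
  have [|V yV VU] := @lc_nbhs_closure y (U `&` ~` [set g | len g <= n%:R]).
    apply: filterI; first exact: yU.
    apply: open_nbhs_nbhs; split=> //.
    exact/closed_openC/length_ball_closed.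
  by exists (y, V).
have [f fP] := choice step.
pose fix st n := if n is m.+1 then f (m, st m) else (1%g, U0).
have stn n : nbhs (st n).1 (st n).2.
  by elim: n => [//|n IHn]; have [] := fP (n, st n) IHn.
have stP n : P n (st n) (st n.+1) by exact: (fP (n, st n) (stn n)).
have st_sub n m : (n <= m)%N -> (st m).2 `<=` (st n).2.
  elim: m => [|m IHm]; first by rewrite leqn0 => /eqP ->.
  rewrite leq_eqVlt => /predU1P[->//|/IHm]; apply: subset_trans.
  move=> y /subset_closure ys; by case: ((stP m).2 y ys).
have stx n : (st n).2 (st n).1 by exact: nbhs_singleton (stn n).
(* A cluster point of the chosen points lies in the closure of every stage, so its length exceeds
   every integer. *)
have [|p [U0p]] := cU0 ((fun n => (st n).1) @ \oo).
  by exists 0%N => // n _; apply: (st_sub 0%N n) => //; exact: stx.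
rewrite clusterE => pcl.
have pst m : closure (st m).2 p.
  apply: pcl; exists m => // n /= mn; apply: (st_sub m n) => //; exact: stx.
have [n ltn] : exists n : nat, len p <= n%:R.
  by exists (Num.truncn (len p)).+1; rewrite ltW// truncnS_gt.
by have [_] := (stP n).2 p (pst n.+1); apply.
Qed.

(** Left translation by x g^-1 carries a neighbourhood of g to one of x, and by subadditivity
    changes lengths by a bounded amount. *)
Lemma length_locally_bounded (g : G) : exists M, \forall h \near g, len h <= M.
Proof.
have [n [x xn]] := length_ball_nbhs.
exists (len (g * x^-1)%g + n%:R).
have cv : (x * g^-1 * h)%g @[h --> g] --> x.
  rewrite -[X in _ --> X](mulgVK g x).
  apply: (@continuous_comp _ _ _ (fun y => (x * g^-1, y)%g)
    (fun p => p.1 * p.2)%g).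
    by apply: cvg_pair; [exact: cvg_cst|exact: cvg_id].
  exact: mulg_continuous.
have gn : \forall h \near g, len (x * g^-1 * h)%g <= n%:R by exact: cv _ xn.
apply: filterS gn => h hn.
have [_ _ _ lenM] := lenP.1.
have := lenM (g * x^-1)%g (x * g^-1 * h)%g.
rewrite !mulgA mulgVK mulgV mul1g => /le_trans; apply.
by rewrite lerD2l.
Qed.

End proper_length.

(** * Gaussian kernels of cocycles *)

Section psd_examples.
Variables (R : realType) (X : Type).
Implicit Types K : X -> X -> R.

Lemma psd_scale (a : R) K : 0 <= a -> psd K -> psd (fun x y => a * K x y).
Proof.
move=> a0 Kpsd; split=> [x y|u]; first by rewrite Kpsd.1.
have -> : gram (fun x y => a * K x y) u u = a * gram K u u.
  rewrite !gramE mulr_sumr; apply: eq_bigr => p _; rewrite mulr_sumr.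
  by apply: eq_bigr => q _; rewrite mulrCA.
by rewrite mulr_ge0// Kpsd.2.
Qed.

Lemma psd0 : psd (fun _ _ : X => 0 : R).
Proof.
split=> // u; rewrite gramE big1// => p _.
by rewrite big1// => q _; rewrite mulr0.
Qed.

Lemma psd_sum (I : Type) (r : seq I) (P : pred I) (F : I -> X -> X -> R) :
  (forall i, P i -> psd (F i)) -> psd (fun x y => \sum_(i <- r | P i) F i x y).
Proof.
move=> Fpsd; elim: r => [|i r IHr].
  rewrite (_ : (fun _ _ => _) = fun _ _ => 0); first exact: psd0.
  by apply/funext => x; apply/funext => y; rewrite big_nil.
have [Pi|nPi] := boolP (P i).
  rewrite (_ : (fun _ _ => _) =
      fun x y => F i x y + \sum_(j <- r | P j) F j x y).
    by apply: psd_add => //; exact: Fpsd.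
  by apply/funext => x; apply/funext => y; rewrite big_cons Pi.
rewrite (_ : (fun _ _ => _) = fun x y => \sum_(j <- r | P j) F j x y)//.
by apply/funext => x; apply/funext => y; rewrite big_cons (negbTE nPi).
Qed.

Lemma psd_exp K n : psd K -> psd (fun x y => K x y ^+ n).
Proof.
move=> Kpsd; elim: n => [|n IHn].
  rewrite (_ : (fun _ _ => _) = fun _ _ => 1 * 1); first exact: psd_rank1.
  by apply/funext => x; apply/funext => y; rewrite expr0 mulr1.
rewrite (_ : (fun _ _ => _) = fun x y => K x y * K x y ^+ n).
  exact: psd_mul.
by apply/funext => x; apply/funext => y; rewrite exprS.
Qed.

(** The exponential series has nonnegative coefficients, and positive kernels are stable under
    products, sums and pointwise limits. *)
Lemma psd_expR K : psd K -> psd (fun x y => expR (K x y)).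
Proof.
move=> Kpsd; apply: (@psd_cvg _ _ nat \oo _
    (fun n x y => series (exp_coeff (K x y)) n)) => [n|x y].
  apply: psd_sum => i _; rewrite (_ : (fun _ _ => _) =
      fun x y => i`!%:R^-1 * K x y ^+ i).
    by apply: psd_scale; [rewrite invr_ge0|exact: psd_exp].
  by apply/funext => x; apply/funext => y; rewrite /exp_coeff /= mulrC.
exact: is_cvg_series_exp_coeff.
Qed.

End psd_examples.

(** The kernel is a sum over the fibres of [s] of rank one kernels; for a given measure only the
    finitely many fibres that it meets matter. *)
Lemma psd_eq_op (R : realType) (X Y : eqType) (s : X -> Y) :
  psd (fun x y => (s x == s y)%:R : R).
Proof.
split=> [x y|u]; first by rewrite eq_sym.
pose Z := undup [seq s p.2 | p <- u].
pose K (x y : X) : R := \sum_(z <- Z) (s x == z)%:R * (s y == z)%:R.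
have Kpsd : psd K by apply: psd_sum => z _; exact: psd_rank1.
have := Kpsd.2 u; rewrite !gramE; congr (_ <= _).
apply: eq_big_seq => p pu; apply: eq_bigr => q _; congr (_ * _).
rewrite /K (bigD1_seq (s p.2)) ?undup_uniq ?mem_undup//=; last exact: map_f.
rewrite eqxx mul1r [s q.2 == _]eq_sym big1 ?addr0// => z.
by rewrite eq_sym => /negbTE ->; rewrite mul0r.
Qed.


(** * The real inner product of a Hilbert space and its Gaussian kernel *)

Section hilbert.
Variables (R : realType) (H : hilbertType R).
Implicit Types v w : H.
Local Open Scope complex_scope.

Lemma hnormE v : `|v| = (hnorm v)%:C.
Proof. by rewrite /hnorm RRe_real// normr_real. Qed.

Lemma hnorm_ge0 v : 0 <= hnorm v.
Proof. by rewrite -ler0c -hnormE. Qed.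

Lemma hnormB_le v w : `|hnorm v - hnorm w| <= hnorm (v - w).
Proof.
have tri (a b : H) : hnorm a <= hnorm (a - b) + hnorm b.
  have : `|a| <= `|a - b| + `|b| by rewrite -{1}(subrK b a) ler_normD.
  by rewrite !hnormE -rmorphD lecR.
have := tri v w; have := tri w v.
have -> : hnorm (w - v) = hnorm (v - w) by rewrite /hnorm distrC.
by rewrite ler_norml => ? ?; apply/andP; split; lra.
Qed.

Lemma hnorm_continuous : continuous (@hnorm R H).
Proof.
move=> v; apply/cvgrPdist_le => e e0.
have ec : 0 < e%:C by rewrite ltcR.
have vw : \forall w \near v, `|v - w| <= e%:C.
  by have /cvgrPdist_le/(_ _ ec) : id @ v --> v by exact: cvg_id.
apply: filterS vw => w; rewrite hnormE lecR; apply: le_trans.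
exact: hnormB_le.
Qed.

Definition rdot v w : R := complex.Re (dotp v w).

Lemma rdotvv v : rdot v v = hnorm v ^+ 2.
Proof. by rewrite /rdot -sqr_normE hnormE -rmorphXn. Qed.

Lemma Re_conjC (z : R[i]) : complex.Re (Num.Def.conjC z) = complex.Re z.
Proof. by case: z. Qed.

Lemma rdotC v w : rdot v w = rdot w v.
Proof.
rewrite /rdot [dotp v w](@hermitian_subproof _ _ _ _ dotp) expr0 mul1r.
exact: Re_conjC.
Qed.

Lemma rdot_linear w (a : R) v v' :
  rdot (a%:C *: v + v') w = a * rdot v w + rdot v' w.
Proof.
rewrite /rdot linearDl/= linearZl_LR /=.
by case: (dotp v w) (dotp v' w) => [? ?] [? ?] /=; ring.
Qed.

Lemma rdotD v v' w : rdot (v + v') w = rdot v w + rdot v' w.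
Proof. by have := rdot_linear w 1 v v'; rewrite scale1r mul1r. Qed.

Lemma rdot0 w : rdot 0 w = 0.
Proof. by have := rdotD 0 0 w; rewrite addr0 => ?; lra. Qed.

Lemma rdotN v w : rdot (- v) w = - rdot v w.
Proof. by have := rdotD v (- v) w; rewrite subrr rdot0 => ?; lra. Qed.

Lemma hnorm_subE v w :
  hnorm (v - w) ^+ 2 = hnorm v ^+ 2 + hnorm w ^+ 2 - 2 * rdot v w.
Proof.
have E a : rdot a (v - w) = rdot v a - rdot w a by rewrite rdotC rdotD rdotN.
by rewrite -!rdotvv rdotD rdotN !E [rdot w v]rdotC; ring.
Qed.

Lemma psd_rdot : psd rdot.
Proof.
split=> [|u]; first exact: rdotC.
have evs v u' : ev (rdot v) u' = rdot v (\sum_(p <- u') (p.1)%:C *: p.2).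
  elim: u' => [|p u' IHu]; first by rewrite ev_nil big_nil rdotC rdot0.
  by rewrite ev_cons big_cons rdotC [RHS]rdotC rdot_linear IHu [rdot v _]rdotC.
rewrite /gram (@ev_ext _ _ _ (rdot (\sum_(p <- u) (p.1)%:C *: p.2))).
  by rewrite evs rdotvv sqr_ge0.
by move=> v; rewrite evs rdotC.
Qed.

(** Expanding the square leaves a rank one kernel times the exponential of a positive kernel. *)
Lemma psd_gaussian (t : R) : 0 <= t ->
  psd (fun v w => expR (- t * hnorm (v - w) ^+ 2)).
Proof.
move=> t0; rewrite (_ : (fun _ _ => _) = fun v w =>
    expR (- t * hnorm v ^+ 2) * expR (- t * hnorm w ^+ 2) *
    expR (2 * t * rdot v w)).
  apply: psd_mul; first exact: psd_rank1.
  by apply: psd_expR; apply: psd_scale; [rewrite mulr_ge0|exact: psd_rdot].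
apply/funext => v; apply/funext => w; rewrite -!expRD; congr expR.
by rewrite hnorm_subE; ring.
Qed.

End hilbert.

(** * Positive definite functions from cocycles of an open subgroup *)

Section truncated_gaussian.
Variables (R : realType) (G : topologicalGroupType) (S : set G).
Variables (H : hilbertType R) (pi : G -> H -> H) (b : G -> H) (t : R).
Hypotheses (Sopen : open_subgroup S) (bP : cocycle S pi b) (t0 : 0 <= t).

Let S1 : S 1%g.
Proof. by have [_ []] := Sopen; rewrite inE. Qed.

Let Sdiv x y : S x -> S y -> S (x * y^-1)%g.
Proof.
by have [_ [_ D]] := Sopen => /mem_set Sx /mem_set Sy; apply/set_mem/D.
Qed.

Let SV x : S x -> S x^-1%g.
Proof. by move=> /(Sdiv S1); rewrite mul1g. Qed.

Let SM x y : S x -> S y -> S (x * y)%g.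
Proof. by move=> Sx /SV /(Sdiv Sx); rewrite invgK. Qed.

Definition truncated_gaussian (g : G) : R :=
  if `[< S g >] then expR (- t * hnorm (b g) ^+ 2) else 0.

Local Notation phi := truncated_gaussian.

Lemma truncated_gaussian_out g : ~ S g -> phi g = 0.
Proof. by rewrite /phi; case: asboolP. Qed.

Lemma truncated_gaussian_in g : S g -> phi g = expR (- t * hnorm (b g) ^+ 2).
Proof. by rewrite /phi; case: asboolP. Qed.

Lemma truncated_gaussian_ge0 g : 0 <= phi g.
Proof. by rewrite /phi; case: asboolP => // _; exact: expR_ge0. Qed.

Lemma truncated_gaussian_le1 g : phi g <= 1.
Proof.
rewrite /phi; case: asboolP => // _; rewrite -expR0 ler_expR mulNr oppr_le0.
by rewrite mulr_ge0// sqr_ge0.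
Qed.

(** The cocycle relation gives pi(x) b(x^-1 y) = b(y) - b(x), and pi(x) is isometric. Thus
    [phi (x^-1 * y)] is, on S, a Gaussian kernel composed with [b]. *)
Lemma hnorm_cocycle_div x y : S x -> S y ->
  hnorm (b (x^-1 * y)%g) = hnorm (b x - b y).
Proof.
move=> Sx Sy; have [[uni _ _ _] _ bM] := bP.
have := bM x (x^-1 * y)%g Sx (SM (SV Sx) Sy); rewrite mulVKg => by_.
have [lin iso _] := uni _ Sx.
have E : hnorm (pi x (b (x^-1 * y)%g)) = hnorm (b (x^-1 * y)%g).
  apply/eqP; rewrite -(@eqrXn2 _ 2) ?hnorm_ge0//.
  by rewrite -!rdotvv /rdot iso.
by rewrite -E by_ /hnorm distrC addrK.
Qed.

Lemma truncated_gaussian1 : phi 1%g = 1.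
Proof.
rewrite truncated_gaussian_in//.
have := hnorm_cocycle_div S1 S1; rewrite mulVg subrr => ->.
have -> : hnorm (0 : H) = 0 by rewrite /hnorm normr0.
by rewrite expr0n mulr0 expR0.
Qed.

(* With [s x] a representative of the coset x S, the kernel is the product of
   the kernel [s x == s y] and of a Gaussian kernel. *)
Lemma psd_truncated_gaussian : psd (fun x y => phi (x^-1 * y)%g).
Proof.
pose s x := xget 1%g [set y | S (x^-1 * y)%g].
have sP x : S (x^-1 * s x)%g.
  apply: (@xgetPex _ 1%g [set y | S (x^-1 * y)%g]).
  by exists x; rewrite /= mulVg.
have hP x : S ((s x)^-1 * x)%g by have := SV (sP x); rewrite invgM invgK.
have s_eq x y : S (x^-1 * y)%g -> s x = s y.
  move=> Sxy; congr xget; apply/seteqP; split=> z /=.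
    by move=> /(SM (SV Sxy)); rewrite invgM invgK mulgA mulgK.
  by move=> /(SM Sxy); rewrite mulgA mulgK.
have E x y : phi (x^-1 * y)%g = (s x == s y)%:R * expR (- t *
    hnorm (b ((s x)^-1 * x)%g - b ((s y)^-1 * y)%g) ^+ 2).
  have [sxy|sxy] := eqVneq (s x) (s y); last first.
    rewrite mul0r truncated_gaussian_out// => /s_eq sxy'.
    by rewrite sxy' eqxx in sxy.
  rewrite mul1r -hnorm_cocycle_div// invgM invgK -sxy.
  have -> : (x^-1 * s x * ((s x)^-1 * y) = x^-1 * y)%g by rewrite mulgA mulgK.
  rewrite truncated_gaussian_in//.
  by have := SM (sP x) (hP y); rewrite -sxy mulgA mulgK.
rewrite (_ : (fun _ _ => _) = fun x y => (s x == s y)%:R * expR (- t *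
    hnorm (b ((s x)^-1 * x)%g - b ((s y)^-1 * y)%g) ^+ 2)).
  apply: psd_mul; first exact: psd_eq_op.
  exact: (psd_comp (fun x => b ((s x)^-1 * x)%g) (psd_gaussian _ t0)).
by apply/funext => x; apply/funext => y; exact: E.
Qed.

(** An open subgroup is also closed: for h close to a point g outside S, the element h^-1 g lies in
    S, so h in S would force g in S. Extension by 0 therefore creates no jump. *)
Lemma truncated_gaussian_continuous : continuous phi.
Proof.
have [Sop _] := Sopen; move=> g; have [Sg|nSg] := pselect (S g).
  have Snear : nbhs g S by apply: open_nbhs_nbhs.
  have bg : {for g, continuous b}.
    have [_ bc _] := bP; rewrite continuous_open_subspace// in bc.
    by apply: bc; rewrite inE.
  have bg2 : hnorm (b h) ^+ 2 @[h --> g] --> hnorm (b g) ^+ 2.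
    rewrite expr2; under eq_fun do rewrite expr2.
    by apply: cvgM; apply: (continuous_comp bg); exact: hnorm_continuous.
  rewrite /continuous_at truncated_gaussian_in//.
  apply: (@cvg_trans _ (expR (- t * hnorm (b h) ^+ 2) @[h --> g])).
    apply: near_eq_cvg; apply: filterS Snear => h Sh.
    by rewrite truncated_gaussian_in.
  apply: continuous_cvg; first exact: continuous_expR.
  by apply: cvgM; [exact: cvg_cst|exact: bg2].
have cv : (h^-1 * g)%g @[h --> g] --> 1%g.
  rewrite -[X in _ --> X](mulVg g).
  apply: (@continuous_comp _ _ _ (fun h => (h^-1, g)%g) (fun p => p.1 * p.2)%g).
    by apply: cvg_pair; [exact: invg_continuous|exact: cvg_cst].
  exact: mulg_continuous.
have out : \forall h \near g, ~ S h.
  have S1n : nbhs 1%g S by apply: open_nbhs_nbhs.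
  have hg : \forall h \near g, S (h^-1 * g)%g by exact: cv _ S1n.
  apply: filterS hg => h Shg Sh; apply: nSg.
  by have := SM Sh Shg; rewrite mulVKg.
rewrite /continuous_at truncated_gaussian_out//.
apply: (@cvg_trans _ ((fun=> 0 : R) @ g)); last exact: cvg_cst.
apply: near_eq_cvg; apply: filterS out => h nSh.
by rewrite truncated_gaussian_out.
Qed.

End truncated_gaussian.

(** The Gromov kernel of 1 - phi at (x, y) is the form of phi evaluated on the differences of point
    masses (x) - (1) and (y) - (1). This is why the total mass is removed at 1. *)
Lemma psd_gromov (R : realType) (G : topologicalGroupType) (phi : G -> R) :
  phi 1%g = 1 -> psd (fun x y => phi (x^-1 * y)%g) ->
  psd (gromov_kernel (fun x => 1 - phi x)).
Proof.
move=> phi1 Kpsd; split=> [x y|u].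
  by rewrite /gromov_kernel (Kpsd.1 x y); ring.
have := Kpsd.2 ((- ev (fun=> 1) u, 1%g) :: u).
rewrite gram_cons; last exact: Kpsd.1.
rewrite /= invg1 mulg1 phi1.
rewrite (@ev_ext _ _ (fun y => phi (1 * y)%g) phi); last first.
  by move=> x; rewrite mul1g.
suff -> : gram (gromov_kernel (fun x => 1 - phi x)) u u =
    ev (fun=> 1) u ^+ 2 - 2 * ev (fun=> 1) u * ev phi u +
    gram (fun x y => phi (x^-1 * y)%g) u u.
  by move=> le0; lra.
rewrite /gram (@ev_ext _ _ _ (fun x => - ev (fun=> 1) u * phi x +
    ((ev (fun=> 1) u - ev phi u) * 1 + ev (fun y => phi (x^-1 * y)%g) u))).
  by rewrite !evP; ring.
move=> x; rewrite (@ev_ext _ _ _ (fun y => (1 - phi x) * 1 +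
    ((- 1) * phi y + phi (x^-1 * y)%g))).
  by rewrite !evP; ring.
by move=> y; rewrite /gromov_kernel; ring.
Qed.

(** * Series of functions of negative type *)

Section kernel_series.
Variables (R : realType) (G : topologicalGroupType) (len : G -> R).
Variables (d : nat -> G -> R) (v : nat -> R) (V C D : R).
Hypothesis len_ge0 : forall g, 0 <= len g.
Hypothesis len_lb : forall g : G, exists M, \forall h \near g, len h <= M.
Hypothesis d_psd : forall k, psd (gromov_kernel (d k)).
Hypothesis d_continuous : forall k, continuous (d k).
Hypothesis d1 : forall k, d k 1%g = 0.
Hypothesis d_ge0 : forall k g, 0 <= d k g.
Hypothesis d_le1 : forall k g, d k g <= 1.
Hypotheses (C0 : 0 <= C) (D0 : 0 <= D).
Hypothesis v_bounds : forall k, 0 <= v k <= V.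
Hypothesis v_cvg0 : v @ \oo --> (0 : R).
(** In this telescoping form the tail from N on is at most [v N] times a quantity depending on
    [len g] alone, hence locally uniformly small. *)
Hypothesis d_tail : forall k g, len g < k%:R ->
  d k g <= (v k - v k.+1) * (C * len g ^+ 2 + D).

Let S n g := series (d ^~ g) n.

Definition kernel_series g : R := limn (series (d ^~ g)).
Local Notation psi := kernel_series.

Let Q g := C * len g ^+ 2 + D.

Let Q0 g : 0 <= Q g.
Proof. by rewrite addr_ge0// mulr_ge0// sqr_ge0. Qed.

Let series_tail N n g : (N <= n)%N -> len g < N%:R ->
  S n g - S N g <= v N * Q g.
Proof.
move=> Nn gN; rewrite /S sub_series Nn.
apply: (@le_trans _ _ (\sum_(N <= k < n) (v k - v k.+1) * Q g)).
  rewrite big_nat [leRHS]big_nat; apply: ler_sum => k /andP[Nk _].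
  by apply: d_tail; apply: lt_le_trans gN _; rewrite ler_nat.
rewrite -mulr_suml ler_wpM2r//.
under eq_bigr do rewrite -opprB.
rewrite sumrN telescope_sumr// opprB gerBl.
by have /andP[] := v_bounds n.
Qed.

Let series_le n g : S n g <= len g + 1 + V * Q g.
Proof.
(* From N on [d_tail] applies; the N earlier terms are at most 1 each, and N is at most |g| + 1. *)
pose N := (Num.truncn (len g)).+1.
have gN : len g < N%:R by exact: truncnS_gt.
have Nle : N%:R <= len g + 1.
  by rewrite -[N]addn1 natrD lerD2r truncn_le.
have SN : S N g <= N%:R.
  rewrite /S /series /=; apply: le_trans (ler_sum _ (fun k _ => d_le1 k g)) _.
  by rewrite sumr_const_nat subn0.
have vN : v N * Q g <= V * Q g.
  by rewrite ler_wpM2r//; have /andP[] := v_bounds N.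
have V0 : 0 <= V * Q g.
  by rewrite mulr_ge0//; have /andP[] := v_bounds 0%N; exact: le_trans.
have [Nn|nN] := leqP N n.
  by have := series_tail Nn gN; lra.
have : S n g <= S N g.
  by apply: (nondecreasing_series (fun k _ _ => d_ge0 k g)); exact: ltnW.
lra.
Qed.

Let series_cvg g : S n g @[n --> \oo] --> psi g.
Proof.
apply: nondecreasing_is_cvgn.
  by apply: nondecreasing_series => k _ _; exact: d_ge0.
by exists (len g + 1 + V * Q g) => _ [n _ <-]; exact: series_le.
Qed.

Lemma kernel_series_ge n g : series (d ^~ g) n <= psi g.
Proof.
apply: nondecreasing_cvgn_le; last exact: series_cvg.
by apply: nondecreasing_series => k _ _; exact: d_ge0.
Qed.

Let kernel_series_tail N g : len g < N%:R -> psi g <= S N g + v N * Q g.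
Proof.
move=> gN; apply: (cvgr_to_le (@series_cvg g)); exists N => // n /= Nn.
by rewrite -lerBlDl; exact: series_tail.
Qed.

Lemma kernel_series_le g : psi g <= len g + 1 + V * (C * len g ^+ 2 + D).
Proof.
by apply: cvgr_to_le (@series_cvg g) _; apply: nearW => n; exact: series_le.
Qed.

Lemma kernel_series1 : psi 1%g = 0.
Proof.
apply: (cvg_unique _ (@series_cvg 1%g)); first exact: Rhausdorff.
rewrite (_ : (fun n => _) = fun=> 0); first exact: cvg_cst.
by apply/funext => n; rewrite /S /series /= big1.
Qed.

Lemma psd_kernel_series : psd (gromov_kernel psi).
Proof.
apply: (@psd_cvg _ _ nat \oo _ (fun n => gromov_kernel (S n))) => [n|x y].
  rewrite (_ : gromov_kernel _ =
      fun x y => \sum_(0 <= k < n) gromov_kernel (d k) x y).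
    by apply: psd_sum => k _; exact: d_psd.
  apply/funext => x; apply/funext => y.
  by rewrite /gromov_kernel sumrB big_split.
by apply: cvgB; [apply: cvgD|]; exact: series_cvg.
Qed.

(** Where [len] is at most M, one partial sum, which is continuous, approximates psi within e / 3;
    local boundedness of [len] provides such a neighbourhood. *)
Lemma kernel_series_continuous : continuous psi.
Proof.
move=> g; apply/cvgrPdist_le => e e0.
have [M gM] := len_lb g.
pose q := C * M ^+ 2 + D + 1.
have q0 : 0 < q by rewrite ltr_wpDl// addr_ge0// mulr_ge0// sqr_ge0.
have eq0 : 0 < e / 3 / q by rewrite !divr_gt0.
have [N [NM vN]] : exists N, M < N%:R /\ v N <= e / 3 / q.
  have v_near : \forall N \near \oo, v N <= e / 3 / q.
    have /cvgrPdist_le/(_ _ eq0) := v_cvg0; apply: filterS => N.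
    by rewrite sub0r normrN; apply: le_trans; exact: ler_norm.
  have Mv : \forall N \near \oo, M < N%:R /\ v N <= e / 3 / q.
    by apply: filterS2 (nbhs_infty_gtr M) v_near => N.
  by have /filter_ex := Mv.
have S_cont n : continuous (S n).
  elim: n => [|n IHn] h.
    rewrite (_ : S 0 = fun=> 0); first exact: cvg_cst.
    by apply/funext => x; rewrite /S /series /= big_geq.
  rewrite (_ : S n.+1 = fun x => S n x + d n x).
    by apply: cvgD; [exact: IHn|exact: d_continuous].
  by apply/funext => x; rewrite /S /series /= big_nat_recr.
have e3 : 0 < e / 3 by rewrite divr_gt0.
have tail h : len h <= M -> 0 <= psi h - S N h <= e / 3.
  move=> hM; rewrite subr_ge0 kernel_series_ge/= lerBlDl.
  apply: le_trans (kernel_series_tail (le_lt_trans hM NM)) _.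
  rewrite lerD2l; apply: (@le_trans _ _ (v N * q)).
    rewrite ler_wpM2l//; first by have /andP[] := v_bounds N.
    rewrite /Q /q -addrA lerD ?lerDl// ler_wpM2l//.
    by rewrite lerXn2r// nnegrE (le_trans (len_ge0 h)).
  by rewrite -ler_pdivlMr.
have gg : len g <= M by exact: nbhs_singleton gM.
have /cvgrPdist_le/(_ _ e3) := S_cont N g; apply: filterS2 gM => h hM.
have /andP[? ?] := tail _ gg; have /andP[? ?] := tail _ hM.
by rewrite !ler_norml => /andP[? ?]; apply/andP; split; lra.
Qed.

End kernel_series.

(** * Compression estimates *)

(** The empty set is covered because its [sup] is 0 by convention. *)
Lemma sup_ge0_le1 (R : realType) (A : set R) :
  (forall x, A x -> 0 <= x <= 1) -> 0 <= sup A <= 1.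
Proof.
move=> A01; have [->|/set0P[x Ax]] := eqVneq A set0.
  by rewrite sup0 lexx ler01.
apply/andP; split.
  have /andP[x0 _] := A01 _ Ax; apply: le_trans x0 _; apply: ub_le_sup => //.
  by exists 1 => y /A01 /andP[].
by apply: ge_sup; [exists x|move=> y /A01 /andP[]].
Qed.

Section compression_bounds.
Variables (R : realType) (G : topologicalGroupType) (len : G -> R).

Lemma compression_ge0_le1 (S : set G) (H : hilbertType R) (b : G -> H) :
  0 <= compression len S b <= 1.
Proof. by apply: sup_ge0_le1 => r []. Qed.

Lemma equivariant_compression_ge0_le1 (S : set G) :
  0 <= equivariant_compression len S <= 1.
Proof.
by apply: sup_ge0_le1 => x [H [pi [b [_ _ ->]]]]; exact: compression_ge0_le1.
Qed.

Lemma inf_compression_le1 (Gs : nat -> set G) : inf_compression len Gs <= 1.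
Proof.
apply: (@le_trans _ _ (equivariant_compression len (Gs 1%N))).
  apply: ge_inf; last by exists 1%N.
  exists 0 => _ [i _ <-].
  by have /andP[] := equivariant_compression_ge0_le1 (Gs i).
by have /andP[] := equivariant_compression_ge0_le1 (Gs 1%N).
Qed.

Lemma le_equivariant_compression (H : hilbertType R) (pi : G -> H -> H)
    (b : G -> H) (r C1 D1 C2 D2 : R) :
  (forall g, 0 <= len g) -> cocycle [set: G] pi b -> 0 <= r <= 1 ->
  0 < C1 -> 0 <= D1 -> 0 <= C2 -> 0 <= D2 ->
  (forall g, C1^-1 * len g `^ r - D1 <= hnorm (b g) <= C2 * len g + D2) ->
  r <= equivariant_compression len [set: G].
Proof.
move=> len0 bP r01 C10 D10 C20 D20 bnd.
apply: (@le_trans _ _ (compression len [set: G] b)).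
  apply: ub_le_sup; first by exists 1 => x [/andP[]].
  (* The definition uses the same two constants in both bounds and wants them positive, hence the
     sums and the 1. *)
  split=> //; exists (C1 + C2), (D1 + D2 + 1); split.
  - by rewrite ltr_wpDr.
  - by rewrite ltr_wpDl// addr_ge0.
  move=> g _; have /andP[lo up] := bnd g; apply/andP; split.
    apply: le_trans lo; apply: lerB; last by rewrite -addrA lerDl addr_ge0.
    rewrite ler_wpM2r ?powR_ge0// lef_pV2 ?posrE ?ltr_wpDr//.
    by rewrite lerDl.
  apply: (le_trans up).
  have := mulr_ge0 (ltW C10) (len0 g); rewrite mulrDl; lra.
apply: ub_le_sup.
  exists 1 => x [H' [pi' [b' [_ _ ->]]]].
  by have /andP[] := compression_ge0_le1 [set: G] b'.
exists H, pi, b; split=> //; exists (C2 + 1), (D2 + 1).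
split; [by rewrite ltr_wpDl|by rewrite ltr_wpDl|] => g _.
have /andP[_ up] := bnd g; apply: (le_trans up).
by have := len0 g; rewrite mulrDl; lra.
Qed.

End compression_bounds.

(** A discrete comparison of the sum of y^-(1 + e) with its integral, shaped to serve as [d_tail].
    With y = x + 1 it follows from ln (1 - 1/y) <= - 1/y and 1 + u <= exp u. *)
Lemma powR_telescope (R : realType) (x e : R) : 0 < x -> 0 < e ->
  (x + 1) `^ (- (1 + e)) <= (x `^ (- e) - (x + 1) `^ (- e)) / e.
Proof.
move=> x0 e0; set y := x + 1; have y0 : 0 < y by rewrite addr_gt0.
have yN : y != 0 by rewrite gt_eqF.
have y1 : 0 < 1 - y^-1.
  by rewrite subr_gt0 invf_lt1// /y ltrDr.
have lnx : ln x <= ln y - y^-1.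
  have -> : x = y * (1 - y^-1) by rewrite mulrBr divff// mulr1 /y addrK.
  by rewrite lnM ?posrE// lerD2l le_ln1Dx// ltrN2 invf_lt1// /y ltrDr.
rewrite ler_pdivlMr// lerBrDr.
rewrite opprD powRD; last by rewrite yN implybT.
rewrite powR_inv1 ?(ltW y0)//.
have -> : y^-1 * y `^ (- e) * e + y `^ (- e) = y `^ (- e) * (1 + e / y) by ring.
apply: (@le_trans _ _ (y `^ (- e) * expR (e / y))).
  by rewrite ler_wpM2l ?powR_ge0// expR_ge1Dx.
rewrite /powR (gt_eqF y0) (gt_eqF x0) -expRD ler_expR.
have := ler_wpM2l (ltW e0) lnx; rewrite mulrBr; lra.
Qed.

Lemma cvg_powRN (R : realType) (e : R) (n : nat) : 0 < e ->
  (k + n)%:R `^ (- e) @[k --> \oo] --> (0 : R).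
Proof.
move=> e0; apply/cvgrPdist_le => c c0.
near=> k; rewrite sub0r normrN ger0_norm ?powR_ge0// powRN.
have y0 := powR_ge0 c^-1 e^-1.
have yk : c^-1 `^ e^-1 <= (k + n)%:R.
  apply: (@le_trans _ _ k%:R); last by rewrite ler_nat leq_addr.
  by near: k; exact: nbhs_infty_ger.
have ck : c^-1 <= (k + n)%:R `^ e.
  have := @ge0_ler_powR _ _ (ltW e0) _ _ y0 _ yk.
  rewrite nnegrE => /(_ (ler0n _ _)).
  by rewrite -powRrM mulVf ?gt_eqF// powRr1// invr_ge0 ltW.
by rewrite invf_ple ?posrE// (lt_le_trans _ ck)// invr_gt0.
Unshelve. all: by end_near. Qed.

Lemma le_equivariant_compression_limit (R : realType)
    (G : topologicalGroupType) (len : G -> R) (Gs : nat -> set G)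
    (alpha l q m r : R) :
  locally_compact [set: G] -> hausdorff_space G ->
  proper_length_function len ->
  (forall i, (0 < i)%N -> open_subgroup (Gs i)) ->
  normalized len Gs -> alpha <= 1 -> 0 <= l -> 0 <= q -> l <= m -> q <= m ->
  0 <= r -> r * (l + m + 1) < alpha -> polynomial_property len Gs alpha l q ->
  r <= equivariant_compression len [set: G].
Proof.
move=> Glc Ght lenP Gs_open Gs_normalized alpha_le1 l0 q0 lm qm r0 r_lt.
move=> [eta [A [B [H [pi [b
  [eta_bnd eta0 AB bP [b_bnd [C [D [C0 D0 AB_le]]]]]]]]]]].
have [[len0 _ _ _] _] := lenP.
(* This choice gives 2 r (l + m + 1 + e) <= 2 alpha - e. *)
pose e := (alpha - r * (l + m + 1)) / (r + 1).
have r1 : 0 < r + 1 by rewrite ltr_wpDl.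
have e0 : 0 < e by rewrite divr_gt0// subr_gt0.
have eE : e * (r + 1) = alpha - r * (l + m + 1) by rewrite divfK// gt_eqF.
clearbody e.
(* The k-th term of the series uses the subgroup of index k + n0. From n0 on every eta is at most
   [e], and n0 > 1 keeps k + n0 - 1, the base in [v] below, at least 1. *)
have [n0 [n0_gt1 eta_le]] : exists n0 : nat, (1 < n0)%N /\
    forall k, eta (k + n0)%N <= e.
  have /cvgrPdist_le/(_ _ e0)[N _ NP] := eta0.
  exists N.+2; split=> // k; have := NP (k + N.+2)%N.
  rewrite /= sub0r normrN => /(_ _)/(le_trans (ler_norm _)); apply.
  by rewrite (leq_trans _ (leq_addl _ _))// -addn2 leq_addr.
have i_gt0 k : (0 < k + n0)%N by rewrite addn_gt0 (ltnW n0_gt1) orbT.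
pose x k : R := (k + n0)%:R.
have x1 k : 1 <= x k by rewrite ler1n.
have x0 k : 0 < x k by rewrite ltr0n.
have xN k : x k != 0 by rewrite gt_eqF.
pose t k := x k `^ (- (m + 1 + e)).
have t0 k : 0 <= t k by exact: powR_ge0.
pose phi k := truncated_gaussian (Gs (k + n0)%N) (b (k + n0)%N) (t k).
pose d k g := 1 - phi k g.
pose v k := (k + n0.-1)%:R `^ (- e) / e.
have len_lb := length_locally_bounded Glc Ght lenP.
have Sop k := Gs_open _ (i_gt0 k).
have cocP k := bP _ (i_gt0 k).
have phi1 k : phi k 1%g = 1 by exact: truncated_gaussian1 (Sop k) (cocP k).
have d_psd k : psd (gromov_kernel (d k)).
  apply: psd_gromov => //.
  exact: psd_truncated_gaussian (Sop k) (cocP k) (t0 k).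
have d_cont k : continuous (d k).
  have phi_cont : continuous (phi k).
    exact: truncated_gaussian_continuous (Sop k) (cocP k).
  by move=> g; apply: cvgB; [exact: cvg_cst|exact: phi_cont].
have d1 k : d k 1%g = 0 by rewrite /d phi1 subrr.
have d_ge0 k g : 0 <= d k g by rewrite subr_ge0 truncated_gaussian_le1.
have d_le1 k g : d k g <= 1 by rewrite gerBl truncated_gaussian_ge0.
have y1 k : 1 <= (k + n0.-1)%:R :> R.
  by rewrite ler1n addn_gt0 -subn1 subn_gt0 n0_gt1 orbT.
have v_bnd k : 0 <= v k <= e^-1.
  rewrite divr_ge0 ?powR_ge0 ?(ltW e0)//= ler_pdivrMr// mulVf ?gt_eqF//.
  by rewrite -[leRHS](powRr0 (k + n0.-1)%:R) ler_powR// oppr_le0 ltW.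
have v_cvg0 : v @ \oo --> (0 : R).
  rewrite -(mul0r e^-1); apply: cvgM; last exact: cvg_cst.
  exact: cvg_powRN.
have b_le k g : Gs (k + n0)%N g ->
    hnorm (b (k + n0)%N g) ^+ 2 <= x k `^ m * (C * len g ^+ 2 + D).
  move=> Gg; have /andP[_ up] := b_bnd _ (i_gt0 k) g Gg; apply: (le_trans up).
  have [Ale Ble] := AB_le _ (i_gt0 k).
  have xlm : x k `^ l <= x k `^ m by exact: ler_powR.
  have xqm : x k `^ q <= x k `^ m by exact: ler_powR.
  rewrite mulrDr mulrA [x k `^ m * C]mulrC [x k `^ m * D]mulrC lerD//.
    rewrite ler_wpM2r ?sqr_ge0//; apply: (le_trans Ale).
    by rewrite ler_pM2l.
  by apply: (le_trans Ble); rewrite ler_pM2l.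
have d_in k g : Gs (k + n0)%N g ->
    d k g = 1 - expR (- t k * hnorm (b (k + n0)%N g) ^+ 2).
  by move=> Gg; rewrite /d /phi truncated_gaussian_in.
have d_tail k g : len g < k%:R ->
    d k g <= (v k - v k.+1) * (C * len g ^+ 2 + D).
  move=> gk; have Gg : Gs (k + n0)%N g.
    apply: Gs_normalized => //; apply: lt_le_trans gk _.
    by rewrite ler_nat leq_addr.
  apply: (@le_trans _ _ (t k * hnorm (b (k + n0)%N g) ^+ 2)).
    rewrite d_in// lerBlDr -lerBlDl; apply: le_trans (expR_ge1Dx _).
    by rewrite mulNr.
  apply: le_trans (ler_wpM2l (t0 k) (b_le _ _ Gg)) _.
  rewrite mulrA ler_wpM2r//.
    by rewrite addr_ge0 ?(ltW D0)// mulr_ge0 ?sqr_ge0 ?(ltW C0).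
  rewrite /t -powRD ?xN ?implybT//.
  have -> : - (m + 1 + e) + m = - (1 + e) by ring.
  have := powR_telescope (lt_le_trans ltr01 (y1 k)) e0.
  have -> : (k + n0.-1)%:R + 1 = x k :> R.
    by rewrite natr1 /x; congr _%:R; rewrite -addnS prednK// ltnW.
  rewrite mulrBl /v (_ : k.+1 + n0.-1 = k + n0)%N//.
  by rewrite addSnnS prednK// ltnW.
have D0' := ltW D0; have C0' := ltW C0.
pose psi := kernel_series d.
have psi1 : psi 1%g = 0.
  exact: kernel_series1 len0 d1 d_ge0 d_le1 C0' D0' v_bnd d_tail.
have psi_psd : psd (gromov_kernel psi).
  exact: psd_kernel_series len0 d_psd d_ge0 d_le1 C0' D0' v_bnd d_tail.
have psi_cont : continuous psi.
  exact: kernel_series_continuous len0 len_lb d_cont d_ge0 d_le1 C0' D0' v_bnd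
    v_cvg0 d_tail.
have psi_le g : psi g <= len g + 1 + e^-1 * (C * len g ^+ 2 + D).
  exact (kernel_series_le len0 d_ge0 d_le1 C0' D0' v_bnd d_tail g).
have psi_ge n g : series (d ^~ g) n <= psi g.
  exact (kernel_series_ge len0 d_ge0 d_le1 C0' D0' v_bnd d_tail n g).
(* E >= 1 gives E y^s <= (E y)^s for s >= 1. The other bound makes the main part of t_i |b_i(g)|^2
   at least D + 1; as t_i B_i <= D, at least 1 remains, and 1 - exp(-1) >= 1/2. *)
pose E := Num.max 1 (C * (D + 1)).
have E1 : 1 <= E by rewrite le_max lexx.
have E0 : 0 < E by exact: lt_le_trans E1.
have d_half k g : 1 <= len g -> x k * E <= len g `^ (2 * r) -> 2^-1 <= d k g.
  move=> g1 xg; have [Gg|nGg] := pselect (Gs (k + n0)%N g); last first.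
    (* Outside the subgroup the term equals 1, so elements that enter the sequence late do no harm
       to the lower bound. *)
    by rewrite /d /phi truncated_gaussian_out// subr0 invf_le1// ler1n.
  have /andP[lo _] := b_bnd _ (i_gt0 k) g Gg.
  have [A0 B0] := AB _ (i_gt0 k); have [Ale Ble] := AB_le _ (i_gt0 k).
  have tB : t k * B (k + n0)%N <= D.
    apply: (le_trans (ler_wpM2l (t0 k) Ble)).
    rewrite mulrCA -[leRHS]mulr1 ler_pM2l// /t -powRD ?xN ?implybT//.
    by rewrite -[leRHS](powRr0 (x k)) ler_powR ?x1//; lra.
  have lenE :
      E * x k `^ (l + m + 1 + e) <= len g `^ (2 * alpha - eta (k + n0)%N).
    have s1 : 1 <= l + m + 1 + e by lra.
    apply: (@le_trans _ _ ((E * x k) `^ (l + m + 1 + e))).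
      by apply: le1r_powRZ => //; exact: ltW.
    apply: (@le_trans _ _ ((len g `^ (2 * r)) `^ (l + m + 1 + e))).
      apply: ge0_ler_powR; rewrite ?nnegrE ?powR_ge0//; first by lra.
        by rewrite mulr_ge0// ltW.
      by rewrite mulrC.
    rewrite -powRrM ler_powR//; have := eta_le k; nra.
  have tA : D + 1 <= t k *
      ((A (k + n0)%N)^-1 * len g `^ (2 * alpha - eta (k + n0)%N)).
    have -> : D + 1 = t k *
        ((C * x k `^ l)^-1 * (C * (D + 1) * x k `^ (l + m + 1 + e))).
      have -> : x k `^ (l + m + 1 + e) = x k `^ l * x k `^ (m + 1 + e).
        by rewrite -powRD ?xN ?implybT//; congr (_ `^ _); ring.
      rewrite /t powRN; field.
      by rewrite (gt_eqF C0) !powR_eq0 !(negbTE (xN k)).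
    apply: ler_wpM2l => //; apply: ler_pM.
    - by rewrite invr_ge0 mulr_ge0 ?powR_ge0.
    - by rewrite !mulr_ge0 ?powR_ge0// addr_ge0.
    - by rewrite lef_pV2 ?posrE ?mulr_gt0 ?powR_gt0.
    - apply: le_trans lenE; rewrite ler_wpM2r ?powR_ge0//.
      by rewrite le_max lexx orbT.
  have tb1 : 1 <= t k * hnorm (b (k + n0)%N g) ^+ 2.
    by have := ler_wpM2l (t0 k) lo; rewrite mulrBr; lra.
  rewrite d_in// lerBrDl -lerBrDr.
  apply: (@le_trans _ _ (expR (- 1))); first by rewrite ler_expR mulNr lerN2.
  rewrite expRN -[leRHS]invrK lef_pV2 ?posrE ?expR_gt0//; last first.
    by rewrite invr_gt0; lra.
  apply: le_trans (expR_ge1Dx 1).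
  have -> : (1 - 2^-1 : R) = 2^-1 by field.
  by rewrite invrK; lra.
have psi_lo g : 1 <= len g -> (len g `^ r) ^+ 2 / E - (n0%:R + 1) <= 2 * psi g.
  move=> g1; have -> : (len g `^ r) ^+ 2 = len g `^ (2 * r).
    by rewrite mulrC powRrM -powR_mulrn ?powR_ge0.
  set y := len g `^ (2 * r) / E.
  have yge0 : 0 <= y by rewrite divr_ge0 ?powR_ge0// ltW.
  (* The terms k < N - n0 satisfy k + n0 < N <= y, so each is at least 1/2. The subtraction is
     truncated: for N <= n0 the sum is empty and the bound is trivial. *)
  pose N := Num.truncn y.
  have Ny : N%:R <= y by rewrite truncn_le.
  have yN : y < N%:R + 1 by rewrite natr1 truncnS_gt.
  have : (N - n0)%:R / 2 <= series (d ^~ g) (N - n0)%N.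
    rewrite /series /= -[X in X%:R](subn0) mulr_natl -sumr_const_nat.
    apply: ler_sum_nat => k /andP[_ kN].
    apply: d_half => //; rewrite -ler_pdivlMr//; apply: le_trans Ny.
    by rewrite ler_nat ltnW// addnC -ltn_subRL.
  have := psi_ge (N - n0)%N g.
  have : N%:R - n0%:R <= (N - n0)%:R :> R.
    by rewrite lerBlDr -natrD ler_nat addnC -leq_subLR.
  by move=> *; lra.
have psi_ge0 g : 0 <= 2 * psi g.
  rewrite mulr_ge0//; apply: le_trans (psi_ge 0%N g).
  by rewrite /series /= big_geq.
have sqE1 : 1 <= Num.sqrt E by rewrite -[leLHS]sqrtr1 ler_wsqrtr.
have n1 : 1 <= Num.sqrt (n0%:R + 1) :> R.
  by rewrite -[leLHS]sqrtr1 ler_wsqrtr// lerDr.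
have e1 : 0 <= e^-1 by rewrite invr_ge0 ltW.
apply: (@le_equivariant_compression _ _ _ _ _ (rkhs_cocycle psi_psd) r
  (Num.sqrt E) (Num.sqrt (n0%:R + 1)) (1 + e^-1 * C) (2 + 2 * (e^-1 * D)) len0).
- exact: rkhs_cocycleP.
- rewrite r0/=; nra.
- by lra.
- by lra.
- by rewrite addr_ge0// mulr_ge0.
- by rewrite addr_ge0// !mulr_ge0.
move=> g; rewrite hnorm_rkhs_cocycle//; apply/andP; split; last first.
  have P0 : 0 <= e^-1 * C by rewrite mulr_ge0.
  have Q0 : 0 <= e^-1 * D by rewrite mulr_ge0.
  have c0 : 0 <= (1 + e^-1 * C) * len g + (2 + 2 * (e^-1 * D)).
    by rewrite addr_ge0 ?mulr_ge0 ?addr_ge0// mulr_ge0.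
  rewrite -[leRHS]ger0_norm// -sqrtr_sqr ler_wsqrtr//.
  have := psi_le g; have := len0 g.
  have -> : e^-1 * (C * len g ^+ 2 + D) = e^-1 * C * len g ^+ 2 + e^-1 * D.
    by ring.
  move: P0 Q0.
  move: (e^-1 * C) (e^-1 * D) (len g) (psi g) => P Q y p P0 Q0 y0 py.
  have ? := mulr_ge0 P0 (sqr_ge0 y); have ? := mulr_ge0 P0 y0.
  have ? := mulr_ge0 Q0 y0; have ? := mulr_ge0 Q0 Q0.
  have ? := mulr_ge0 (mulr_ge0 P0 P0) (sqr_ge0 y).
  have ? := mulr_ge0 (mulr_ge0 P0 Q0) y0; have ? := sqr_ge0 y.
  by lra.
have s0 := sqrtr_ge0 (2 * psi g).
(* For |g| < 1 the power is at most 1 and the additive constant, itself at least 1, absorbs it;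
   otherwise the bound is [psi_lo] after squaring. *)
rewrite lerBlDr; have [g1|g1] := leP 1 (len g); last first.
  apply: (@le_trans _ _ 1); last by lra.
  rewrite ler_pdivrMl ?mulr1; last by lra.
  apply: le_trans sqE1; have <- : 1 `^ r = 1 :> R by rewrite powR1.
  by apply: ge0_ler_powR; rewrite ?nnegrE// ltW.
rewrite -(@ler_pXn2r _ 2) ?nnegrE ?addr_ge0 ?mulr_ge0 ?invr_ge0 ?powR_ge0
  ?sqrtr_ge0//.
rewrite exprMn exprVn sqr_sqrtr ?(ltW E0)// sqrrD !sqr_sqrtr//.
have := psi_lo g g1.
have : 0 <= Num.sqrt (2 * psi g) * Num.sqrt (n0%:R + 1).
  by rewrite mulr_ge0// sqrtr_ge0.
by rewrite [E^-1 * _]mulrC => *; lra.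
Qed.

Theorem theorem1p4 (R : realType) (G : topologicalGroupType) (len : G -> R)
    (Gs : nat -> set G) (alpha l q : R)
    (Glc : locally_compact [set: G])
    (Ght : hausdorff_space G)
    (Gsc : @second_countable G)
    (lenP : proper_length_function len)
    (Gs_open : forall i, (0 < i)%N -> open_subgroup (Gs i))
    (Gs_nested : nested Gs)
    (Gs_normalized : normalized len Gs)
    (alphaE : alpha = inf_compression len Gs)
    (alpha_gt0 : 0 < alpha)
    (l_ge0 : 0 <= l) (q_ge0 : 0 <= q)
    (Gs_poly : polynomial_property len Gs alpha l q) :
  (q <= l -> alpha / (2 * l + 1) <= equivariant_compression len [set: G]) /\
  (l <= q -> alpha / (l + q + 1) <= equivariant_compression len [set: G]).
Proof.
have alpha_le1 : alpha <= 1 by rewrite alphaE inf_compression_le1.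
have key m : l <= m -> q <= m ->
    alpha / (l + m + 1) <= equivariant_compression len [set: G].
  move=> lm qm; rewrite leNgt; apply/negP => ec_lt.
  have s0 : 0 < l + m + 1 by lra.
  have /andP[ec0 _] := equivariant_compression_ge0_le1 len [set: G].
  (* Only exponents strictly below the bound are realized, so the contradiction comes from the
     midpoint between the compression and the claimed value. *)
  have := midf_lt ec_lt; set r := (_ + _) / 2 => -[ec_r].
  rewrite ltr_pdivlMr// => r_lt.
  have r0 : 0 <= r by rewrite (le_trans ec0)// ltW.
  have := le_equivariant_compression_limit Glc Ght lenP Gs_open Gs_normalized
    alpha_le1 l_ge0 q_ge0 lm qm r0 r_lt Gs_poly.
  by rewrite leNgt ec_r.
split=> [ql|lq]; last exact: key.
by have := key l (lexx l) ql; rewrite mulr_natl mulr2n.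
Qed.
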